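(* Let $J=J(a,b)$ and $\tilde J=J(\tilde a,\tilde b)$ be proper (possibly unbounded) Jacobi matrices with Jacobi parameters $(a_n)_{n\in\mathbb N_0},(\tilde a_n)_{n\in\mathbb N_0}\in(0,\infty)^{\mathbb N_0}$ and $(b_n)_{n\in\mathbb N_0},(\tilde b_n)_{n\in\mathbb N_0}\in\mathbb C^{\mathbb N_0}$, and with Weyl matrix functions $M,\tilde M$ respectively. Let $N\ge2$ be an integer. Then the following are equivalent: (1) There exist $\epsilon>0$ and a sequence $w_j\to\infty$ with $\arg(w_j)\in[\epsilon,2\pi-\epsilon]$ for all $j$ such that $$\left\|w_j^{\sigma_3/4}\bigl(M(w_j)-\tilde M(w_j)\bigr)w_j^{\sigma_3/4}\right\|=\mathcal O(w_j^{-N}),\qquad j\to\infty.$$ (2) $a_n=\tilde a_n$ and $b_n=\tilde b_n$ for all $0\le n\le N-2$. (3) For every $\epsilon>0$, as $w\to\infty$ in the sector $\arg(w)\in[\epsilon,2\pi-\epsilon]$, $$\left\|w^{\sigma_3/4}\bigl(M(w)-\tilde M(w)\bigr)w^{\sigma_3/4}\right\|=\mathcal O(w^{-N}).$$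
   Context: $\mathbb N_0=\{0,1,2,\dots\}$; $(\delta_n)_{n\ge0}$ is the standard basis of $\ell^2(\mathbb N_0)$; inner products are linear in the second argument. For $a\in(0,\infty)^{\mathbb N_0}$, $b\in\mathbb C^{\mathbb N_0}$ (not assumed bounded), the Jacobi matrix acts on sequences by $(Ju)_n=a_{n-1}u_{n-1}+b_nu_n+a_nu_{n+1}$ (with the $a_{-1}u_{-1}$ term omitted for $n=0$), and $J=J(a,b)$ denotes the operator on $\ell^2(\mathbb N_0)$ with maximal domain $D(J)=\{u\in\ell^2(\mathbb N_0): Ju\in\ell^2(\mathbb N_0)\}$. $J_0(a,b)$ is its restriction to the finitely supported sequences. $J(a,b)$ is proper if $\overline{J_0(a,b)}=J(a,b)$. Weyl matrix function: with $\mathbf e_0=\delta_0$ and $\mathbf e_1=J^*\delta_0$, set $M(z)=(M_{i,j}(z))_{i,j=0}^1$, $M_{i,j}(z)=\langle\mathbf e_j,(J^*J-z)^{-1}\mathbf e_i\rangle$, for $z\in\mathbb C\setminus[0,+\infty)$; $\tilde M$ is defined in the same way from $\tilde J$ (with $\tilde{\mathbf e}_1=\tilde J^*\delta_0$). For $w\in\mathbb C\setminus[0,+\infty)$, $w^{\sigma_3/4}=\begin{pmatrix}w^{1/4}&0\\0&1/w^{1/4}\end{pmatrix}$ with the branch $\arg(w^{1/4})\in(0,\pi/2)$. $\mathcal O(w^{-N})$ means bounded by a constant times $|w|^{-N}$. *)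

(* Defs.v *)
From mathcomp Require Import all_boot all_order all_algebra.
From mathcomp Require Import complex.
From mathcomp Require Import all_classical all_reals all_analysis.

Set Implicit Arguments.
Unset Strict Implicit.
Unset Printing Implicit Defensive.

Import Order.TTheory GRing.Theory Num.Theory numFieldNormedType.Exports.

Local Open Scope classical_set_scope.
Local Open Scope ring_scope.
Local Open Scope complex_scope.

(* The modulus [Normc.normc] of [z : R[i]] is used instead of [`|z|] when an
   element of [R] is needed. *)

Section SquareSummable.
Variable R : realType.
Implicit Types u v f : nat -> R[i].

Definition l2 : set (nat -> R[i]) :=
  [set u | cvgn (series (fun n => Normc.normc (u n) ^+ 2))].

Definition l2norm u : R :=
  Num.sqrt (limn (series (fun n => Normc.normc (u n) ^+ 2))).

Definition csum f : R[i] :=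
  limn (series (fun n => complex.Re (f n)))
    +i* limn (series (fun n => complex.Im (f n))).

(* Linear in the second argument. *)
Definition inner u v : R[i] := csum (fun n => (u n)^* * v n).

Definition finsupp : set (nat -> R[i]) :=
  [set u | exists m, forall n, (m <= n)%N -> u n = 0].

Definition delta (k : nat) : nat -> R[i] := fun n => (n == k)%:R.

End SquareSummable.

Arguments delta {R} k.

(* A possibly unbounded operator on l^2 is represented by its graph, a set of
   pairs (u, T u) of square-summable sequences. *)
Section Operators.
Variable R : realType.
Local Notation cseq := (nat -> R[i]).
Local Notation graph := (set (cseq * cseq)).
Implicit Types (S T : graph) (u v f g : cseq) (z : R[i]).

Definition closure_op T : graph :=
  [set p | [/\ l2 p.1, l2 p.2 &
    exists q : nat -> cseq * cseq,
      [/\ forall k, T (q k),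
          l2norm ((q k).1 - p.1) @[k --> \oo] --> (0 : R) &
          l2norm ((q k).2 - p.2) @[k --> \oo] --> (0 : R)]]].

Definition adjoint T : graph :=
  [set p | [/\ l2 p.1, l2 p.2 &
    forall q, T q -> inner p.1 q.2 = inner p.2 q.1]].

Definition comp_op S T : graph :=
  [set p | exists2 v, T (p.1, v) & S (v, p.2)].

(* The value T u; it is 0 when u is not in the domain of T. *)
Definition app_op T u : cseq := xget 0 [set v | T (u, v)].

(* (T - z)^{-1} f is the u in the domain of T such that T u - z u = f. *)
Definition resolvent T z f : cseq :=
  xget 0 [set u | exists2 g, T (u, g) & forall n, g n - z * u n = f n].

End Operators.

Section Jacobi.
Variable R : realType.
Implicit Types (a : nat -> R) (b u : nat -> R[i]) (z : R[i]).

Definition jacobi_act a b u : nat -> R[i] := fun n =>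
  (if n is m.+1 then (a m)%:C * u m else 0) + b n * u n + (a n)%:C * u n.+1.

Definition jacobi a b : set ((nat -> R[i]) * (nat -> R[i])) :=
  [set p | [/\ l2 p.1, l2 p.2 & p.2 = jacobi_act a b p.1]].

Definition jacobi0 a b : set ((nat -> R[i]) * (nat -> R[i])) :=
  [set p | jacobi a b p /\ finsupp p.1].

Definition proper_jacobi a b : Prop := closure_op (jacobi0 a b) = jacobi a b.

Definition weyl_vec a b (i : 'I_2) : nat -> R[i] :=
  if i == 0 then delta 0 else app_op (adjoint (jacobi a b)) (delta 0).

Definition weyl a b z : 'M[R[i]]_2 := \matrix_(i, j)
  inner (weyl_vec a b j)
    (resolvent (comp_op (adjoint (jacobi a b)) (jacobi a b)) z
       (weyl_vec a b i)).

End Jacobi.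

Section Asymptotics.
Variable R : realType.
Implicit Types (w : R[i]) (A : 'M[R[i]]_2).

Definition l2norm2 (v : 'cV[R[i]]_2) : R :=
  Num.sqrt (\sum_i Normc.normc (v i 0) ^+ 2).

Definition opnorm A : R :=
  sup [set l2norm2 (A *m v) | v in [set v | l2norm2 v <= 1]].

(* [4.-root w] is the fourth root of minimal nonnegative argument, so that for
   w outside [0, +oo[ its argument lies in ]0, pi/2[. *)
Definition sigma3_quarter w : 'M[R[i]]_2 :=
  diag_mx (\row_(i < 2) if i == 0 then 4.-root w else (4.-root w)^-1).

(* w <> 0 with arg w in [eps, 2 pi - eps]. *)
Definition sector (eps : R) : set R[i] :=
  [set w | exists r t : R,
    [/\ 0 < r, eps <= t <= 2 * pi - eps & w = (r * cos t) +i* (r * sin t)]].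

End Asymptotics.

(* Main.v *)
(** With [z ^+ 2 = w], the matrix [w^(sigma_3/4) M(w) w^(sigma_3/4)] collects, up
    to a term [1/z] that does not depend on [J], the entries at site 0 of the
    square-summable solutions of the Dirac-type system [J^* Q - z P = f delta_0],
    [J P - z Q = g delta_0] for [(f, g) = (1, 0)] and [(0, 1)]. Properness of [J]
    makes an energy identity available, which bounds these solutions by [O(1/z)]
    in a sector; the three-term recurrence then improves the bound at site [n] to
    [O(z^-(n+1))] and yields the leading term
    [- a_0 ... a_(n-1) z^-(n+1)] on alternating components.
    For two Jacobi matrices agreeing below site [n], Green's identity turns the
    difference at site 0 into a boundary term at site [n], which is
    [O(z^-(2n+2))], has leading coefficient [(a_0 ... a_(n-1))^2 (b_n - b'_n)] (or
    its conjugate, according to the parity of [n]), and, once [b_n = b'_n], next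
    coefficient [(a_0 ... a_(n-1))^2 (a_n^2 - a'_n^2)]. *)

Require Import Defs.
From mathcomp Require Import all_boot all_order all_algebra.
From mathcomp Require Import complex.
From mathcomp Require Import all_classical all_reals all_analysis.
From mathcomp Require Import ring lra zify.

Set Implicit Arguments.
Unset Strict Implicit.
Unset Printing Implicit Defensive.

Import Order.TTheory GRing.Theory Num.Theory numFieldNormedType.Exports.

Local Open Scope classical_set_scope.
Local Open Scope ring_scope.
Local Open Scope complex_scope.

Local Notation "x ^*" := (conjc x) : ring_scope.

(** * Complex modulus and convergence *)

Section ComplexModulus.
Variable R : realType.
Implicit Types x y : R[i].
Local Notation nrm := (@Normc.normc R).

Lemma normcD x y : nrm (x + y) <= nrm x + nrm y.
Proof. exact: le_normcD. Qed.

Lemma normcB x y : nrm (x - y) <= nrm x + nrm y.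
Proof. by rewrite -(normcN y); exact: normcD. Qed.

Lemma normc_ge0 x : 0 <= nrm x.
Proof. by case: x => p q; exact: sqrtr_ge0. Qed.

Lemma normc_sqr x : nrm x ^+ 2 = complex.Re x ^+ 2 + complex.Im x ^+ 2.
Proof. by case: x => p q /=; rewrite sqr_sqrtr // addr_ge0 // sqr_ge0. Qed.

Lemma normc_conj x : nrm x^* = nrm x.
Proof. by case: x => p q /=; rewrite sqrrN. Qed.

Lemma normcX x n : nrm (x ^+ n) = nrm x ^+ n.
Proof.
by elim: n => [|n IH]; rewrite ?expr0 ?Normc.normc1 // !exprS Normc.normcM IH.
Qed.

Lemma normc_sum (I : Type) (r : seq I) (P : pred I) (f : I -> R[i]) :
  nrm (\sum_(i <- r | P i) f i) <= \sum_(i <- r | P i) nrm (f i).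
Proof.
elim/big_ind2 : _ => //; first by rewrite Normc.normc0.
by move=> x p y q xp yq; apply: le_trans (normcD _ _) (lerD xp yq).
Qed.

Lemma normc_eq0 x : (nrm x == 0) = (x == 0).
Proof.
by apply/eqP/eqP => [/Normc.eq0_normc|->]; rewrite ?Normc.normc0.
Qed.

Lemma normc_gt0 x : (0 < nrm x) = (x != 0).
Proof. by rewrite lt_def normc_ge0 andbT normc_eq0. Qed.

Lemma mul_conjc x : x^* * x = (nrm x ^+ 2)%:C.
Proof.
rewrite normc_sqr; case: x => p q; apply/eqP.
by rewrite eq_complex /=; apply/andP; split; apply/eqP; ring.
Qed.

Lemma Re_le_normc x : `|complex.Re x| <= nrm x.
Proof.
rewrite -(@ler_pXn2r _ 2) ?nnegrE ?normc_ge0 // normc_sqr real_normK ?num_real //.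
by rewrite lerDl sqr_ge0.
Qed.

Lemma Im_le_normc x : `|complex.Im x| <= nrm x.
Proof.
rewrite -(@ler_pXn2r _ 2) ?nnegrE ?normc_ge0 // normc_sqr real_normK ?num_real //.
by rewrite lerDr sqr_ge0.
Qed.

Lemma ReD x y : complex.Re (x + y) = complex.Re x + complex.Re y.
Proof. by case: x => ? ?; case: y. Qed.

Lemma ImD x y : complex.Im (x + y) = complex.Im x + complex.Im y.
Proof. by case: x => ? ?; case: y. Qed.

Lemma ReM x y : complex.Re (x * y) =
  complex.Re x * complex.Re y - complex.Im x * complex.Im y.
Proof. by case: x => ? ?; case: y. Qed.

Lemma ImM x y : complex.Im (x * y) =
  complex.Re x * complex.Im y + complex.Im x * complex.Re y.
Proof. by case: x => ? ?; case: y => ? ? /=; rewrite addrC. Qed.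

Lemma complex_ReIm x : x = complex.Re x +i* complex.Im x.
Proof. by case: x. Qed.

End ComplexModulus.

Section ComplexConvergence.
Variable R : realType.
Local Notation nrm := (@Normc.normc R).

(** Componentwise convergence matches [csum], which sums real and imaginary parts separately, and
    reduces every limit to real ones. *)
Definition ccvg (T : Type) (F : set_system T) (f : T -> R[i]) (l : R[i]) :=
  (complex.Re (f t) @[t --> F] --> complex.Re l) /\
  (complex.Im (f t) @[t --> F] --> complex.Im l).

Section Filter.
Variables (T : Type) (F : set_system T).
Context {FF : ProperFilter F}.
Implicit Types (f g : T -> R[i]).

Lemma ccvg_cst (c : R[i]) : ccvg F (fun=> c) c.
Proof. by split; exact: cvg_cst. Qed.

Lemma ccvgD f g l m : ccvg F f l -> ccvg F g m -> ccvg F (fun t => f t + g t) (l + m).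
Proof.
move=> [f1 f2] [g1 g2]; split; rewrite ?ReD ?ImD.
- by under eq_fun do rewrite ReD; exact: cvgD.
- by under eq_fun do rewrite ImD; exact: cvgD.
Qed.

Lemma ccvgZ (c : R[i]) f l : ccvg F f l -> ccvg F (fun t => c * f t) (c * l).
Proof.
move=> [f1 f2]; split; rewrite ?ReM ?ImM.
- under eq_fun do rewrite ReM.
  by apply: cvgB; apply: cvgMl_tmp; assumption.
- under eq_fun do rewrite ImM.
  by apply: cvgD; apply: cvgMl_tmp; assumption.
Qed.

Lemma ccvg_uniq f l m : ccvg F f l -> ccvg F f m -> l = m.
Proof.
move=> [f1 f2] [g1 g2]; rewrite (complex_ReIm l) (complex_ReIm m).
by congr (_ +i* _); [apply: cvg_unique f1 g1 | apply: cvg_unique f2 g2].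
Qed.

Lemma ccvg_near f g l : (\forall t \near F, f t = g t) -> ccvg F f l -> ccvg F g l.
Proof.
move=> fg [f1 f2]; split.
- apply: cvg_trans f1; apply: near_eq_cvg.
  by apply: filterS fg => t /= ->.
- apply: cvg_trans f2; apply: near_eq_cvg.
  by apply: filterS fg => t /= ->.
Qed.

End Filter.
End ComplexConvergence.

(** * Square-summable sequences *)

Section Series.
Variable R : realType.
Implicit Types (f g u v : nat -> R[i]) (c l : R[i]).
Local Notation nrm := (@Normc.normc R).

Lemma Re_series f n : complex.Re (series f n) = series (fun k => complex.Re (f k)) n.
Proof.
rewrite /series /=; elim: n => [|n IH]; first by rewrite !big_geq.
by rewrite !big_nat_recr //= ReD IH.
Qed.

Lemma Im_series f n : complex.Im (series f n) = series (fun k => complex.Im (f k)) n.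
Proof.
rewrite /series /=; elim: n => [|n IH]; first by rewrite !big_geq.
by rewrite !big_nat_recr //= ImD IH.
Qed.

(** [csum] has a value even for a divergent series, so convergence is carried along with the sum. *)
Definition hassum f l := ccvg \oo (series f) l.

Lemma hassum_csum f l : hassum f l -> csum f = l.
Proof.
move=> [f1 f2]; rewrite (complex_ReIm l) /csum; congr (_ +i* _).
- by apply/cvg_lim => //; rewrite -(funext (Re_series f)).
- by apply/cvg_lim => //; rewrite -(funext (Im_series f)).
Qed.

Lemma hassumD f g l l' : hassum f l -> hassum g l' ->
  hassum (fun n => f n + g n) (l + l').
Proof.
move=> fl gl'; apply: ccvg_near (ccvgD fl gl').
by apply: nearW => n; rewrite /series /= big_split.
Qed.

Lemma hassumZ c f l : hassum f l -> hassum (fun n => c * f n) (c * l).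
Proof.
move=> fl; apply: ccvg_near (ccvgZ c fl).
by apply: nearW => n; rewrite /series /= mulr_sumr.
Qed.

Lemma series_eventually_cst (V : zmodType) (h : nat -> V) m n :
  (forall k, (m <= k)%N -> h k = 0) -> (m <= n)%N -> series h n = series h m.
Proof.
move=> h0 mn; rewrite /series /= (big_cat_nat _ mn) //=.
rewrite [X in _ + X]big_nat_cond [X in _ + X]big1 ?addr0 // => k.
by rewrite andbT => /andP[mk _]; exact: h0.
Qed.

Lemma hassum_finite f m : (forall k, (m <= k)%N -> f k = 0) ->
  hassum f (series f m).
Proof.
move=> f0; apply: ccvg_near (ccvg_cst (series f m)).
by exists m => // n /= mn; rewrite (series_eventually_cst f0 mn).
Qed.

Lemma csum_finite f m : (forall k, (m <= k)%N -> f k = 0) ->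
  csum f = series f m.
Proof. by move=> f0; apply: hassum_csum; apply: hassum_finite. Qed.

Lemma cvg_series_abs_le (h B : nat -> R) : (forall n, `|h n| <= B n) ->
  cvgn (series B) -> cvgn (series h).
Proof.
move=> hB cB; apply: normed_cvg.
apply: series_le_cvg cB => n; [exact: normr_ge0| |exact: hB].
by apply: le_trans (hB n); exact: normr_ge0.
Qed.

Lemma hassum_abs f : cvgn (series (fun n => nrm (f n))) -> hassum f (csum f).
Proof.
move=> cf; split.
- under eq_fun do rewrite Re_series.
  by apply: cvg_series_abs_le cf => n; exact: Re_le_normc.
- under eq_fun do rewrite Im_series.
  by apply: cvg_series_abs_le cf => n; exact: Im_le_normc.
Qed.

Lemma ccvg_normc_le (T : Type) (F : set_system T) (FF : ProperFilter F)
    (f : T -> R[i]) l (B : R) :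
  ccvg F f l -> (\forall t \near F, nrm (f t) <= B) -> nrm l <= B.
Proof.
move=> [f1 f2] fB.
have B0 : 0 <= B.
  have [t tB] := filter_ex fB.
  exact: le_trans (normc_ge0 _) tB.
rewrite -(@ler_pXn2r _ 2) ?nnegrE ?normc_ge0 // normc_sqr !expr2.
have c12 : complex.Re (f t) * complex.Re (f t) + complex.Im (f t) * complex.Im (f t)
    @[t --> F] --> complex.Re l * complex.Re l + complex.Im l * complex.Im l.
  by apply: cvgD; apply: cvgM.
rewrite -(cvg_lim _ c12) //; apply: limr_le; first by apply/cvg_ex; eexists; exact: c12.
apply: filterS fB => t tB.
by rewrite -!expr2 -normc_sqr ler_pXn2r ?nnegrE ?normc_ge0.
Qed.

End Series.

(** * Square-summable sequences and their bilinear pairing *)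

Section SquareSummable.
Variable R : realType.
Implicit Types (f g u v w : nat -> R[i]) (c : R[i]).
Local Notation nrm := (@Normc.normc R).
Local Notation ssq u := (series (fun n => nrm (u n) ^+ 2)).

Lemma series_nondecreasing (h : nat -> R) : (forall n, 0 <= h n) ->
  {homo series h : n m / (n <= m)%N >-> n <= m}.
Proof.
move=> h0 n m nm; rewrite /series /= (big_cat_nat _ nm) //= lerDl.
by apply: sumr_ge0.
Qed.

Lemma l2_bounded u (B : R) : (forall n, ssq u n <= B) -> l2 u.
Proof.
move=> uB; rewrite /l2 /=; apply: nondecreasing_is_cvgn.
  by apply: series_nondecreasing => n; rewrite exprn_ge0 // normc_ge0.
by exists B => _ [n _ <-]; exact: uB.
Qed.

Definition sqnorm u : R := limn (ssq u).

Lemma ssq_le_sqnorm u n : l2 u -> ssq u n <= sqnorm u.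
Proof.
move=> u2; apply: nondecreasing_cvgn_le => //.
by apply: series_nondecreasing => k; rewrite exprn_ge0 // normc_ge0.
Qed.

Lemma sqnorm_ge0 u : l2 u -> 0 <= sqnorm u.
Proof. by move=> /(ssq_le_sqnorm 0); rewrite /series /= big_geq. Qed.

Lemma le_sqnorm u n : l2 u -> nrm (u n) ^+ 2 <= sqnorm u.
Proof.
move=> u2; apply: le_trans (ssq_le_sqnorm n.+1 u2).
rewrite /series /= big_nat_recr //= lerDr.
by apply: sumr_ge0 => k _; rewrite exprn_ge0 // normc_ge0.
Qed.

Lemma l2norm_sqr u : l2 u -> l2norm u ^+ 2 = sqnorm u.
Proof. by move=> u2; rewrite sqr_sqrtr //; exact: sqnorm_ge0. Qed.

Lemma l2D u v : l2 u -> l2 v -> l2 (fun n => u n + v n).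
Proof.
move=> u2 v2; apply: (@l2_bounded _ (2 * sqnorm u + 2 * sqnorm v)) => n.
apply: (@le_trans _ _ (2 * ssq u n + 2 * ssq v n)).
  rewrite /series /= !mulr_sumr -big_split /=; apply: ler_sum => k _.
  have := normcD (u k) (v k); have := normc_ge0 (u k + v k).
  move: (nrm _) (nrm (u k)) (nrm (v k)) => x p q x0 xpq.
  apply: (@le_trans _ _ ((p + q) ^+ 2)).
    by rewrite ler_pXn2r ?nnegrE // (le_trans x0).
  by rewrite -subr_ge0; have := sqr_ge0 (p - q); lra.
by apply: lerD; rewrite ler_pM2l //; apply: ssq_le_sqnorm.
Qed.

Lemma l2Z c u : l2 u -> l2 (fun n => c * u n).
Proof.
move=> u2; apply: (@l2_bounded _ (nrm c ^+ 2 * sqnorm u)) => n.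
rewrite /series /=; under eq_bigr do rewrite Normc.normcM exprMn.
rewrite -mulr_sumr; apply: ler_wpM2l; first by rewrite exprn_ge0 ?normc_ge0.
exact: ssq_le_sqnorm.
Qed.

Lemma l2B u v : l2 u -> l2 v -> l2 (fun n => u n - v n).
Proof.
move=> u2 v2; have := l2D u2 (l2Z (c := -1) v2).
by under eq_fun do rewrite mulN1r.
Qed.

Lemma l2_conj u : l2 u -> l2 (fun n => (u n)^*).
Proof. by rewrite /l2 /=; under [in X in _ -> X]eq_fun do rewrite normc_conj. Qed.

Lemma l2_finite u m : (forall k, (m <= k)%N -> u k = 0) -> l2 u.
Proof.
move=> u0; apply: (@l2_bounded _ (ssq u m)) => n.
have z0 k : (m <= k)%N -> nrm (u k) ^+ 2 = 0.
  by move=> /u0 ->; rewrite Normc.normc0 expr0n.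
have [mn|nm] := leqP m n; first by rewrite (series_eventually_cst z0 mn).
apply: series_nondecreasing (ltnW nm) => k.
by rewrite exprn_ge0 // normc_ge0.
Qed.

Lemma delta_eq0 k n : (k < n)%N -> delta k n = 0 :> R[i].
Proof. by rewrite /delta; case: (ltngtP n k). Qed.

Lemma l2_delta k : l2 (delta k : nat -> R[i]).
Proof. by apply: (@l2_finite _ k.+1) => n kn; apply: delta_eq0. Qed.

(** The bilinear pairing: a Jacobi matrix with complex [b] is symmetric for it, whereas [inner]
    turns [b] into its conjugate. *)
Definition dot u v := csum (fun n => u n * v n).

Lemma innerE u v : inner u v = dot (fun n => (u n)^*) v.
Proof. by []. Qed.

Lemma dotC u v : dot u v = dot v u.
Proof. by rewrite /dot; congr csum; apply/funext => n; rewrite mulrC. Qed.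

Lemma hassum_dot u v : l2 u -> l2 v ->
  hassum (fun n => u n * v n) (dot u v).
Proof.
move=> u2 v2; apply: hassum_abs.
have : cvgn (series (fun n => nrm (u n) ^+ 2 + nrm (v n) ^+ 2)).
  by rewrite seriesD; apply: is_cvgD.
apply: series_le_cvg => n; rewrite ?normc_ge0 ?addr_ge0 ?exprn_ge0 ?normc_ge0 //.
rewrite Normc.normcM; have := normc_ge0 (u n); have := normc_ge0 (v n).
by nra.
Qed.

Lemma dotDr u v w : l2 u -> l2 v -> l2 w ->
  dot u (fun n => v n + w n) = dot u v + dot u w.
Proof.
move=> u2 v2 w2; apply: hassum_csum.
under eq_fun do rewrite mulrDr.
by apply: hassumD; apply: hassum_dot.
Qed.

Lemma dotZr c u v : l2 u -> l2 v ->
  dot u (fun n => c * v n) = c * dot u v.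
Proof.
move=> u2 v2; apply: hassum_csum.
under eq_fun do rewrite mulrCA.
by apply: hassumZ; apply: hassum_dot.
Qed.

Lemma dotDl u v w : l2 u -> l2 v -> l2 w ->
  dot (fun n => v n + w n) u = dot v u + dot w u.
Proof. by move=> u2 v2 w2; rewrite dotC dotDr // (dotC v) (dotC w). Qed.

Lemma dotZl c u v : l2 u -> l2 v ->
  dot (fun n => c * v n) u = c * dot v u.
Proof. by move=> u2 v2; rewrite dotC dotZr // (dotC v). Qed.

Lemma dot_delta u k : dot u (delta k) = u k.
Proof.
rewrite /dot (@csum_finite _ _ k.+1) => [|n kn]; last first.
  by rewrite delta_eq0 // mulr0.
rewrite /series /= big_nat_recr //= {2}/delta eqxx mulr1.
rewrite big_nat_cond big1 ?add0r // => n; rewrite andbT => /andP[_ nk].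
by rewrite /delta ltn_eqF // mulr0.
Qed.

Lemma conj_csum f l : hassum f l -> csum (fun n => (f n)^*) = l^*.
Proof.
move=> [f1 f2]; apply: hassum_csum; split.
- have -> : complex.Re l^* = complex.Re l by case: l {f1 f2}.
  apply: cvg_trans f1; apply: near_eq_cvg; apply: nearW => n.
  by rewrite !Re_series; congr series; apply/funext => k; case: (f k).
- have -> : complex.Im l^* = - complex.Im l by case: l {f1 f2}.
  apply: cvg_trans (cvgN f2); apply: near_eq_cvg; apply: nearW => n.
  rewrite -[LHS]/(- complex.Im (series f n)) !Im_series /series /= -sumrN; apply: eq_bigr => k _.
  by case: (f k).
Qed.

Lemma conj_dot u v : l2 u -> l2 v ->
  (dot u v)^* = dot (fun n => (u n)^*) (fun n => (v n)^*).
Proof.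
move=> u2 v2; rewrite -(conj_csum (hassum_dot u2 v2)) /dot; congr csum.
by apply/funext => n; rewrite rmorphM.
Qed.

Lemma dot_conj_self u : l2 u -> dot (fun n => (u n)^*) u = (sqnorm u)%:C.
Proof.
move=> u2; apply: hassum_csum; split.
- apply: cvg_trans u2; apply: near_eq_cvg; apply: nearW => n.
  by rewrite Re_series; congr series; apply/funext => k; rewrite mul_conjc.
- under eq_fun do rewrite Im_series.
  have -> : (fun n => complex.Im ((u n)^* * u n)) = fun=> 0.
    by apply/funext => k; rewrite mul_conjc.
  under eq_fun do rewrite /series /= big1 //.
  exact: cvg_cst.
Qed.

(** Cauchy-Schwarz with slack: the [+ 1] keeps the weight [A] positive even for [u = 0]. In later
    use the second factor tends to zero, so the larger constant is harmless. *)
Lemma normc_dot u v : l2 u -> l2 v ->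
  nrm (dot u v) <= (l2norm u + 1) * l2norm v.
Proof.
move=> u2 v2; set A := l2norm u + 1.
have A0 : 0 < A by rewrite ltr_wpDl ?ltr01 // sqrtr_ge0.
suff H e : 0 < e -> nrm (dot u v) <= A * (l2norm v + e).
  apply/ler_addgt0Pr => e e0.
  apply: le_trans (H (e / A) _) _; first exact: divr_gt0.
  by rewrite mulrDr mulrCA mulfV ?gt_eqF // mulr1.
move=> e0; set B := l2norm v + e.
have B0 : 0 < B by rewrite ltr_wpDl // sqrtr_ge0.
have := @ccvg_normc_le _ _ _ _ _ _ (A * B) (hassum_dot u2 v2).
apply; apply: nearW => n.
apply: le_trans (normc_sum _ _ _) _.
(* Weighted arithmetic-geometric mean; the weights are chosen so that the bounds [A ^+ 2] and
   [B ^+ 2] on the two sums recombine to [A * B]. *)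
apply: (@le_trans _ _ (2^-1 * (B / A) * ssq u n + 2^-1 * (A / B) * ssq v n)).
  rewrite /series /= !mulr_sumr -big_split /=; apply: ler_sum => k _.
  rewrite Normc.normcM; move: (nrm (u k)) (nrm (v k)) => p q.
  have := sqr_ge0 (B * p - A * q).
  have -> : 2^-1 * (B / A) * p ^+ 2 + 2^-1 * (A / B) * q ^+ 2 =
     p * q + (B * p - A * q) ^+ 2 / (2 * A * B).
    by field; rewrite !gt_eqF.
  by move=> h; rewrite lerDl divr_ge0 // !mulr_ge0 // ltW.
have uA : ssq u n <= A ^+ 2.
  apply: le_trans (ssq_le_sqnorm n u2) _; rewrite -l2norm_sqr //.
  by rewrite ler_pXn2r ?nnegrE ?sqrtr_ge0 ?(ltW A0) // lerDl.
have vB : ssq v n <= B ^+ 2.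
  apply: le_trans (ssq_le_sqnorm n v2) _; rewrite -l2norm_sqr //.
  by rewrite ler_pXn2r ?nnegrE ?sqrtr_ge0 ?(ltW B0) // lerDl ltW.
have -> : A * B = 2^-1 * (B / A) * A ^+ 2 + 2^-1 * (A / B) * B ^+ 2.
  by field; rewrite !gt_eqF.
by apply: lerD; apply: ler_wpM2l => //; rewrite mulr_ge0 // ?invr_ge0 // divr_ge0 // ltW.
Qed.

End SquareSummable.

(** * Jacobi matrices *)

Section JacobiAction.
Variable R : realType.
Implicit Types (a : nat -> R) (b p q u v : nat -> R[i]) (c : R[i]).
Local Notation nrm := (@Normc.normc R).
Local Notation bar u := (fun n => (u n)^*).

Lemma jacobi_act0 a b u : jacobi_act a b u 0%N = b 0%N * u 0%N + (a 0%N)%:C * u 1%N.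
Proof. by rewrite /jacobi_act add0r. Qed.

Lemma jacobi_actS a b u n : jacobi_act a b u n.+1 =
  (a n)%:C * u n + b n.+1 * u n.+1 + (a n.+1)%:C * u n.+2.
Proof. by []. Qed.

Lemma jacobi_actD a b u v n :
  jacobi_act a b (fun k => u k + v k) n = jacobi_act a b u n + jacobi_act a b v n.
Proof. by case: n => [|n]; rewrite /jacobi_act; ring. Qed.

Lemma jacobi_actZ a b c u n :
  jacobi_act a b (fun k => c * u k) n = c * jacobi_act a b u n.
Proof. by case: n => [|n]; rewrite /jacobi_act; ring. Qed.

Lemma conj_realC (x : R) : (x%:C : R[i])^* = x%:C.
Proof. exact: conjc_real. Qed.

Lemma conj_jacobi_act a b u n :
  (jacobi_act a b u n)^* = jacobi_act a (bar b) (bar u) n.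
Proof.
have cD (x y : R[i]) : (x + y)^* = x^* + y^* by exact: rmorphD.
have cM (x y : R[i]) : (x * y)^* = x^* * y^* by exact: rmorphM.
by case: n => [|n]; rewrite ?jacobi_act0 ?jacobi_actS !cD !cM !conj_realC.
Qed.

Lemma jacobi_act_finite a b u m n : (forall k, (m <= k)%N -> u k = 0) ->
  (m < n)%N -> jacobi_act a b u n = 0.
Proof.
move=> u0; case: n => // n mn.
by rewrite /jacobi_act !u0 ?mulr0 ?addr0 // ltnW // ltnW.
Qed.

(** Discrete Green identity: the sum telescopes, since below [n] the two sets of coefficients
    coincide and the symmetric terms cancel. *)
Lemma green a a' b b' p q n :
  (forall k, (k < n)%N -> a k = a' k /\ b k = b' k) ->
  series (fun k => p k * jacobi_act a b q k - q k * jacobi_act a' b' p k) n.+1 =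
  (b n - b' n) * p n * q n + (a n)%:C * p n * q n.+1 - (a' n)%:C * p n.+1 * q n.
Proof.
rewrite /series /=; elim: n => [|n IH] eqab.
  by rewrite big_nat1 !jacobi_act0; ring.
rewrite big_nat_recr //= IH => [|k kn]; last exact/eqab/ltnW.
by rewrite !jacobi_actS; have [<- <-] := eqab n (ltnSn n); ring.
Qed.

(** This is [green] with equal coefficients; its boundary term vanishes because [q] is zero at [m]
    and [m.+1]. *)
Lemma dot_jacobi_finite a b p q m : (forall k, (m <= k)%N -> q k = 0) ->
  dot p (jacobi_act a b q) = dot (jacobi_act a b p) q.
Proof.
move=> q0; rewrite /dot (@csum_finite _ _ m.+1); last first.
  by move=> k mk; rewrite (jacobi_act_finite _ _ q0) ?mulr0.
rewrite (@csum_finite _ _ m.+1); last by move=> k mk; rewrite q0 ?mulr0 // ltnW.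
apply/eqP; rewrite -subr_eq0; apply/eqP.
have := @green a a b b p q m (fun _ _ => conj erefl erefl).
rewrite !q0 // !mulr0 subr0 addr0 => <-.
by rewrite /series /= -sumrB; apply: eq_bigr => k _; rewrite [q k * _]mulrC.
Qed.

Lemma l2_jacobi_finite a b u m : (forall k, (m <= k)%N -> u k = 0) ->
  l2 (jacobi_act a b u).
Proof.
move=> u0; apply: (@l2_finite _ _ m.+1) => n mn.
exact: jacobi_act_finite u0 mn.
Qed.

Lemma inner_jacobi_finite a b p q m : (forall k, (m <= k)%N -> q k = 0) ->
  inner p (jacobi_act a b q) = inner (jacobi_act a (bar b) p) q.
Proof.
move=> q0; rewrite !innerE (dot_jacobi_finite _ _ _ q0); congr dot.
apply/funext => n; rewrite conj_jacobi_act; congr jacobi_act.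
by apply/funext => k; rewrite conjcK.
Qed.

(** Properness supplies finitely supported sequences converging to [q] in graph norm; the identity
    holds for each of them and passes to the limit. *)
Lemma proper_inner_jacobi a b p q : proper_jacobi a b ->
  l2 q -> l2 (jacobi_act a b q) -> l2 p -> l2 (jacobi_act a (bar b) p) ->
  inner p (jacobi_act a b q) = inner (jacobi_act a (bar b) p) q.
Proof.
move=> proper q2 Jq2 p2 Jp2.
have : jacobi a b (q, jacobi_act a b q) by [].
rewrite -proper => -[_ _ [x [xJ x1 x2]]] /=.
apply/eqP; rewrite -subr_eq0 -normc_eq0 eq_le normc_ge0 andbT.
set A := _ - _.
pose A1 := l2norm (bar p) + 1; pose A2 := l2norm (bar (jacobi_act a (bar b) p)) + 1.
(* By Cauchy-Schwarz [nrm A <= s k] for every [k]; the varying factors of [s k] are the two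
   graph-norm errors, so [s] tends to zero. *)
pose s k := A1 * l2norm ((x k).2 - jacobi_act a b q) + A2 * l2norm ((x k).1 - q).
have s0 : s k @[k --> \oo] --> 0.
  rewrite (_ : 0 = A1 * 0 + A2 * 0); last by rewrite !mulr0 addr0.
  by apply: cvgD; apply: cvgMl_tmp.
rewrite -(cvg_lim _ s0) //; apply: limr_ge; first by apply/cvg_ex; exists 0.
apply: nearW => k; have [[l1 l2' e2] [m x0]] := xJ k; rewrite /s.
have d2 : l2 ((x k).2 - jacobi_act a b q) by exact: l2B.
have d1 : l2 ((x k).1 - q) by exact: l2B.
have pb2 := l2_conj p2; have Jpb2 := l2_conj Jp2.
have eqk : inner p (x k).2 = inner (jacobi_act a (bar b) p) (x k).1.
  by rewrite e2; exact: inner_jacobi_finite x0.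
have -> : A = dot (bar (jacobi_act a (bar b) p)) ((x k).1 - q)
              - dot (bar p) ((x k).2 - jacobi_act a b q).
  have dB u v w : l2 u -> l2 v -> l2 w -> dot u (v - w) = dot u v - dot u w.
    move=> u2 v2 w2; have -> : v - w = (fun n => v n + -1 * w n).
      by apply/funext => n; rewrite mulN1r.
    by rewrite dotDr // ?dotZr ?mulN1r //; apply: l2Z.
  by rewrite !dB // -!innerE eqk /A; ring.
apply: le_trans (normcB _ _) _; rewrite addrC.
by apply: lerD; apply: normc_dot.
Qed.

(** Testing the adjoint relation on [delta n] and its image reads off coordinate [n] of [q]. *)
Lemma adjoint_jacobi a b p q : adjoint (jacobi a b) (p, q) ->
  [/\ l2 p, l2 q & q = jacobi_act a (bar b) p].
Proof.
move=> [/= p2 q2 H]; split => //; apply/funext => n.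
have d0 k : (n < k)%N -> delta n k = 0 :> R[i] by exact: delta_eq0.
have := H (delta n, jacobi_act a b (delta n)); rewrite /= (inner_jacobi_finite _ _ _ d0).
rewrite !innerE !dot_delta => /(_ _)/(can_inj (@conjcK R)) -> //.
by split => //=; [exact: l2_delta | exact: l2_jacobi_finite d0].
Qed.

Lemma proper_adjoint_jacobi a b p : proper_jacobi a b ->
  l2 p -> l2 (jacobi_act a (bar b) p) ->
  adjoint (jacobi a b) (p, jacobi_act a (bar b) p).
Proof.
move=> proper p2 Jp2; split => // -[q r] [/= q2 r2 re].
by rewrite re; apply: proper_inner_jacobi => //; rewrite -re.
Qed.

End JacobiAction.

(** * The Dirac system *)

Section DiracSystem.
Variable R : realType.
Implicit Types (a : nat -> R) (b P Q : nat -> R[i]) (z w f g : R[i]) (c : R).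
Local Notation nrm := (@Normc.normc R).
Local Notation bar u := (fun n => (u n)^*).

(** First-order form of [J^* J - z ^+ 2]: eliminating [Q] gives [J^* J P = z ^+ 2 P + z f delta_0 +
    g J^* delta_0], so the two unit sources yield, up to scaling, the resolvent at the two Weyl
    vectors. *)
Definition dirac_system a b z f g P Q := forall n,
  jacobi_act a (bar b) Q n = z * P n + f * delta 0 n /\
  jacobi_act a b P n = z * Q n + g * delta 0 n.

(** For [c > 0] this limits the cancellation between [x] and [w * y]; it is the form in which the
    angle between [w] and the positive half-line enters the estimates. *)
Definition away c w := forall x y : R, 0 <= x -> 0 <= y ->
  c * (x + nrm w * y) <= nrm (x%:C - w * y%:C).

(** [X] and [Y] stand for the squared norms of [P] and [Q], full or truncated, and [p], [q] for
    their values at site 0. After multiplication by [z] the left side of the identity has modulus at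
    least [c |z|^2 (X + Y)], while the right side is at most [|z| (|f| + |g|) sqrt (X + Y)]. *)
Lemma energy_bound c z f g (p q : R[i]) (X Y : R) :
  0 < c -> z != 0 -> away c (z ^+ 2) ->
  nrm p ^+ 2 <= X -> nrm q ^+ 2 <= Y ->
  z * Y%:C - z^* * X%:C = f^* * p - g * q^* ->
  X + Y <= ((nrm f + nrm g) / (c * nrm z)) ^+ 2.
Proof.
move=> c0 z0 cz pX qY E.
have X0 : 0 <= X by apply: le_trans pX; rewrite exprn_ge0 // normc_ge0.
have Y0 : 0 <= Y by apply: le_trans qY; rewrite exprn_ge0 // normc_ge0.
have r0 : 0 < nrm z by rewrite normc_gt0.
have F0 : 0 <= nrm f + nrm g by rewrite addr_ge0 ?normc_ge0.
pose S := Num.sqrt (X + Y).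
have S0 : 0 <= S by exact: sqrtr_ge0.
have S2 : S ^+ 2 = X + Y by rewrite sqr_sqrtr // addr_ge0.
have pS : nrm p <= S.
  by rewrite -(@ler_pXn2r _ 2) ?nnegrE ?normc_ge0 // S2 ler_wpDr.
have qS : nrm q <= S.
  by rewrite -(@ler_pXn2r _ 2) ?nnegrE ?normc_ge0 // S2 ler_wpDl.
have := cz (nrm z ^+ 2 * X) Y (mulr_ge0 (exprn_ge0 2 (normc_ge0 z)) X0) Y0.
have -> : (nrm z ^+ 2 * X)%:C - z ^+ 2 * Y%:C = - (z * (z * Y%:C - z^* * X%:C)).
  by rewrite rmorphM /= -mul_conjc; ring.
rewrite normcX normcN Normc.normcM E -mulrDr -S2 => H.
have H2 : c * (nrm z ^+ 2 * S ^+ 2) <= nrm z * ((nrm f + nrm g) * S).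
  apply: le_trans H _; apply: ler_wpM2l; first exact: normc_ge0.
  apply: le_trans (normcB _ _) _; rewrite !Normc.normcM !normc_conj mulrDl.
  by apply: lerD; apply: ler_wpM2l => //; exact: normc_ge0.
have [->|Sn] := eqVneq S 0; first by rewrite expr0n sqr_ge0.
have {Sn}S1 : 0 < S by rewrite lt_def Sn.
have d0 : 0 < c * nrm z by exact: mulr_gt0.
rewrite ler_pXn2r ?nnegrE ?divr_ge0 ?(ltW d0) //.
rewrite ler_pdivlMr // -(ler_pM2r (mulr_gt0 r0 S1)).
have -> : S * (c * nrm z) * (nrm z * S) = c * (nrm z ^+ 2 * S ^+ 2) by ring.
by have -> : (nrm f + nrm g) * (nrm z * S) = nrm z * ((nrm f + nrm g) * S) by ring.
Qed.

Lemma l2_dirac a b z f g P Q : l2 P -> l2 Q -> dirac_system a b z f g P Q ->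
  l2 (jacobi_act a (bar b) Q) /\ l2 (jacobi_act a b P).
Proof.
move=> P2 Q2 PQ; split.
  rewrite (funext (fun n => (PQ n).1)).
  by apply: l2D; apply: l2Z => //; exact: l2_delta.
rewrite (funext (fun n => (PQ n).2)).
by apply: l2D; apply: l2Z => //; exact: l2_delta.
Qed.

(** Inserting the system into [<Q, J P> = <J^* Q, P>] gives the energy identity required by
    [energy_bound]. *)
Lemma dirac_bound c a b z f g P Q : proper_jacobi a b ->
  0 < c -> z != 0 -> away c (z ^+ 2) -> l2 P -> l2 Q ->
  dirac_system a b z f g P Q -> forall n,
  nrm (P n) <= (nrm f + nrm g) / (c * nrm z) /\
  nrm (Q n) <= (nrm f + nrm g) / (c * nrm z).
Proof.
move=> proper c0 z0 cz P2 Q2 PQ n.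
have [JQ2 JP2] := l2_dirac P2 Q2 PQ.
have := proper_inner_jacobi proper P2 JP2 Q2 JQ2; rewrite !innerE.
have Pb2 := l2_conj P2; have Qb2 := l2_conj Q2; have d2 := @l2_delta R 0.
rewrite (funext (fun n => (PQ n).2)) dotDr ?dotZr //; try exact: l2Z.
have -> : (fun k => (jacobi_act a (bar b) Q k)^*) =
    (fun k => z^* * (P k)^* + f^* * delta 0 k).
  apply/funext => k; rewrite (PQ k).1 rmorphD !rmorphM /=.
  by congr (_ + _ * _); rewrite /delta; case: eqP => _; rewrite ?rmorph1 ?rmorph0.
rewrite dotDl ?dotZl //; try exact: l2Z.
rewrite !dot_conj_self // dot_delta (dotC (delta 0)) dot_delta => E.
have B := @energy_bound c z f g (P 0%N) (Q 0%N) (sqnorm P) (sqnorm Q) c0 z0 cz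
   (le_sqnorm 0 P2) (le_sqnorm 0 Q2).
have {}B : sqnorm P + sqnorm Q <= ((nrm f + nrm g) / (c * nrm z)) ^+ 2.
  apply: B; apply/eqP; rewrite subr_eq addrAC eq_sym subr_eq; apply/eqP.
  by rewrite addrC -E; ring.
have K0 : 0 <= (nrm f + nrm g) / (c * nrm z).
  by rewrite divr_ge0 ?addr_ge0 ?mulr_ge0 ?normc_ge0 ?(ltW c0).
split; rewrite -(@ler_pXn2r _ 2) ?nnegrE ?normc_ge0 //; apply: le_trans B.
  by rewrite ler_wpDr ?sqnorm_ge0 //; exact: le_sqnorm.
by rewrite ler_wpDl ?sqnorm_ge0 //; exact: le_sqnorm.
Qed.

(** Symmetry of [J] for [dot] on the pair [P0], [P1], and of its conjugate on [Q0], [Q1], gives two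
    identities with the same [z]-terms; only the sources at site 0 differ. It makes the two diagonal
    entries of the scaled difference equal. *)
Lemma dirac_symm a b z P0 Q0 P1 Q1 : proper_jacobi a b -> l2 P0 -> l2 Q0 ->
  l2 P1 -> l2 Q1 -> dirac_system a b z 1 0 P0 Q0 -> dirac_system a b z 0 1 P1 Q1 ->
  P0 0%N = Q1 0%N.
Proof.
move=> proper P02 Q02 P12 Q12 D0 D1.
have [JQ02 JP02] := l2_dirac P02 Q02 D0.
have [JQ12 JP12] := l2_dirac P12 Q12 D1.
have cJ b' u : (fun n => (jacobi_act a b' u n)^*) = jacobi_act a (bar b') (bar u).
  by apply/funext => n; exact: conj_jacobi_act.
have barK (u : nat -> R[i]) : bar (bar u) = u by apply/funext => n; exact: conjcK.
have d2 := @l2_delta R 0.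
have E1 : dot P0 (jacobi_act a b P1) = dot (jacobi_act a b P0) P1.
  have := proper_inner_jacobi proper P12 JP12 (l2_conj P02).
  rewrite !innerE cJ !barK => -> //.
  by rewrite -cJ; exact: l2_conj.
have E2 : dot Q1 (jacobi_act a (bar b) Q0) = dot (jacobi_act a (bar b) Q1) Q0.
  have := proper_inner_jacobi proper (l2_conj Q02) _ Q12 JQ12.
  rewrite !innerE => /(_ _)/(congr1 conjc).
  rewrite -{1 2}[b]barK -cJ => /(_ (l2_conj JQ02)).
  by rewrite !conj_dot ?barK //; apply: l2_conj => //; apply: l2_conj.
move: E1 E2.
rewrite (funext (fun n => (D0 n).1)) (funext (fun n => (D0 n).2)).
rewrite (funext (fun n => (D1 n).1)) (funext (fun n => (D1 n).2)).
rewrite !dotDr ?dotDl ?dotZr ?dotZl // ?dot_delta; try exact: l2Z.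
rewrite (dotC (delta 0)) dot_delta (dotC (delta 0)) dot_delta.
rewrite (dotC Q1 P0) (dotC P1 Q0).
rewrite !mul0r !mul1r !addr0 => E1 E2.
by apply: (@addrI _ (z * dot P0 Q1)); rewrite E1 E2.
Qed.

Lemma normc_polar (r t : R) : 0 <= r -> nrm ((r * cos t) +i* (r * sin t)) = r.
Proof.
move=> r0; apply/eqP; rewrite -(@eqrXn2 _ 2) ?normc_ge0 // normc_sqr /=.
by rewrite !exprMn -mulrDr cos2Dsin2 mulr1.
Qed.

(** With [s = r y], [|x - s e^(it)|^2] is at least [x^2 + s^2 - 2 x s cos eps], which equals [(1 -
    cos eps)/2 (x + s)^2 + (1 + cos eps)/2 (x - s)^2]. The first summand gives the constant. *)
Lemma sector_away (eps : R) w : 0 < eps -> sector eps w ->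
  away (Num.sqrt ((1 - cos eps) / 2)) w.
Proof.
move=> eps0 [r [t [r0 /andP[et te] ->]]] x y x0 y0.
have epspi : eps <= pi by lra.
have epsI : eps \in `[0, pi] by rewrite in_itv /= ltW.
have cos_le s : eps <= s -> s <= pi -> cos s <= cos eps.
  move=> es sp; have sI : s \in `[0, pi] by rewrite in_itv /= sp (le_trans _ es) // ltW.
  by rewrite le_eqVlt ltr_cos // orbC -implyNb -leNgt; apply/implyP => se;
    rewrite (@le_anti _ _ s eps) // se.
have ce : cos t <= cos eps.
  (* Beyond [pi], [t] is reflected to [2 pi - t], which again lies between [eps] and [pi], where the
     cosine decreases. *)
  have [tp|pt] := leP t pi; first exact: cos_le.
  rewrite -cosN -cosD2pi -mulr_natl; apply: cos_le; lra.
have c1 := cos_le1 eps.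
have r2 := normc_polar t (ltW r0).
rewrite r2; have k0 : 0 <= (1 - cos eps) / 2 by rewrite divr_ge0 // subr_ge0.
have ry0 : 0 <= r * y by rewrite mulr_ge0 // ltW.
rewrite -(@ler_pXn2r _ 2) ?nnegrE ?normc_ge0 ?mulr_ge0 ?sqrtr_ge0 ?addr_ge0 //.
rewrite exprMn sqr_sqrtr // normc_sqr ReD ImD /= !mulr0.
have -> : (x - (r * cos t * y - 0)) ^+ 2 + (0 - (0 + r * sin t * y)) ^+ 2 =
    x ^+ 2 + (r * y) ^+ 2 * (cos t ^+ 2 + sin t ^+ 2) - 2 * x * (r * y) * cos t.
  by ring.
rewrite cos2Dsin2 mulr1.
apply: (@le_trans _ _ (x ^+ 2 + (r * y) ^+ 2 - 2 * x * (r * y) * cos eps)).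
  have := cos_geN1 eps; have := sqr_ge0 (x - r * y).
  set ce' := cos eps; set s := r * y => h1 h2; rewrite -subr_ge0.
  have -> : x ^+ 2 + s ^+ 2 - 2 * x * s * ce' - (1 - ce') / 2 * (x + s) ^+ 2 =
    (1 + ce') / 2 * (x - s) ^+ 2 by field.
  by rewrite mulr_ge0 // divr_ge0 // -lerBlDl sub0r.
rewrite lerD2l lerN2; apply: ler_wpM2l => //.
by rewrite mulr_ge0 // mulr_ge0.
Qed.

(** A point of the sector forces [eps <= pi], hence [cos eps < 1]. *)
Lemma sector_away_gt0 (eps : R) w : 0 < eps -> sector eps w ->
  0 < Num.sqrt ((1 - cos eps) / 2).
Proof.
move=> eps0 [r [t [r0 /andP[et te] _]]].
rewrite sqrtr_gt0 divr_gt0 // subr_gt0 -cos0.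
have pi0 := pi_ge0 R.
by rewrite ltr_cos // in_itv /= ?lexx ?(ltW eps0) //; lra.
Qed.

End DiracSystem.

(** * Existence of square-summable solutions *)

Section DiracExistence.
Variable R : realType.
Variables (a : nat -> R) (b : nat -> R[i]) (z : R[i]) (c : R).
Hypotheses (a_gt0 : forall n, 0 < a n) (c_gt0 : 0 < c) (z_neq0 : z != 0).
Hypothesis zc : away c (z ^+ 2).
Local Notation nrm := (@Normc.normc R).
Local Notation bar u := (fun n => (u n)^*).
Local Notation ssq u := (series (fun n => nrm (u n) ^+ 2)).
Implicit Types (P Q : nat -> R[i]).

Lemma dirac_initial (x y f g : R[i]) : exists P Q,
  [/\ P 0%N = x, Q 0%N = y & dirac_system a b z f g P Q].
Proof.
pose A n : R[i] := if n is m.+1 then (a m)%:C else 0.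
(* The state at [n] holds the values of [(P, Q)] at sites [n - 1] and [n]; as [a n] is nonzero, the
   two recurrences can be solved for site [n + 1]. The fictitious site [-1] carries zeros. *)
pose next n (s : (R[i] * R[i]) * (R[i] * R[i])) := (s.2,
  ((z * s.2.2 + g * delta 0 n - b n * s.2.1 - A n * s.1.1) / (a n)%:C,
   (z * s.2.1 + f * delta 0 n - (b n)^* * s.2.2 - A n * s.1.2) / (a n)%:C)).
pose s := fix s n := if n is m.+1 then next m (s m) else ((0, 0), (x, y)).
exists (fun n => (s n).2.1), (fun n => (s n).2.2); split => // n.
have an0 : (a n)%:C != 0 :> R[i] by rewrite eq_complex /= gt_eqF.
have -> P : jacobi_act a (bar b) P n =
    A n * (if n is m.+1 then P m else 0) + (b n)^* * P n + (a n)%:C * P n.+1.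
  by case: n {an0} => [|n] //; rewrite jacobi_act0 mul0r add0r.
have -> P : jacobi_act a b P n =
    A n * (if n is m.+1 then P m else 0) + b n * P n + (a n)%:C * P n.+1.
  by case: n {an0} => [|n] //; rewrite jacobi_act0 mul0r add0r.
have -> : s n.+1 = next n (s n) by [].
rewrite /next /= ![_%:C * (_ / _)]mulrC !divfK //.
have E : A n * (if n is m.+1 then (s m).2.1 else 0) = A n * (s n).1.1.
  by case: (n) => [|m] //=; rewrite mulr0.
have E' : A n * (if n is m.+1 then (s m).2.2 else 0) = A n * (s n).1.2.
  by case: (n) => [|m] //=; rewrite mulr0.
by rewrite E E'; split; ring.
Qed.

Lemma dirac_comb (l m f f' g g' : R[i]) P P' Q Q' :
  dirac_system a b z f g P Q -> dirac_system a b z f' g' P' Q' ->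
  dirac_system a b z (l * f + m * f') (l * g + m * g')
    (fun n => l * P n + m * P' n) (fun n => l * Q n + m * Q' n).
Proof.
move=> D D' n; rewrite !jacobi_actD !jacobi_actZ.
rewrite (D n).1 (D n).2 (D' n).1 (D' n).2.
by split; ring.
Qed.

(** Vanishing at [n.+1] removes the boundary term of [green], so the sums over sites [0] to [n]
    satisfy the same energy identity as a full square-summable solution. *)
Lemma dirac_truncated_energy f g P Q n : dirac_system a b z f g P Q ->
  P n.+1 = 0 -> Q n.+1 = 0 ->
  ssq P n.+1 + ssq Q n.+1 <= ((nrm f + nrm g) / (c * nrm z)) ^+ 2.
Proof.
move=> D P0 Q0.
have le0 u : nrm (u 0%N) ^+ 2 <= ssq u n.+1.
  rewrite /series /= big_nat_recl //= lerDl.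
  by apply: sumr_ge0 => k _; rewrite exprn_ge0 // normc_ge0.
apply: (energy_bound (p := P 0%N) (q := Q 0%N) c_gt0 z_neq0 zc) => //.
have := @green R a a b b (bar Q) P n (fun _ _ => conj erefl erefl).
rewrite /= P0 Q0 conjc0 subrr !(mul0r, mulr0) subr0 addr0.
have -> : series (fun k => (Q k)^* * jacobi_act a b P k
    - P k * jacobi_act a b (bar Q) k) n.+1 =
  z * (ssq Q n.+1)%:C + g * (Q 0%N)^* - (z^* * (ssq P n.+1)%:C + f^* * P 0%N).
  have dl u : series (fun k => u k * delta 0 k) n.+1 = u 0%N :> R[i].
    rewrite /series /= big_nat_recl //= big1 ?addr0 => [|k _]; rewrite /delta /=.
      by rewrite mulr1.
    by rewrite mulr0.
  rewrite -(dl (fun k => g * (Q k)^*)) -(dl (fun k => f^* * P k)).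
  rewrite /series /= !rmorph_sum !mulr_sumr -!big_split /= -sumrB.
  apply: eq_bigr => k _.
  have -> : jacobi_act a b (bar Q) k = (jacobi_act a (bar b) Q k)^*.
    rewrite conj_jacobi_act; congr jacobi_act.
    by apply/funext => i; rewrite conjcK.
  rewrite (D k).1 (D k).2.
  have -> : (z * P k + f * delta 0 k)^* = z^* * (P k)^* + f^* * delta 0 k.
    rewrite rmorphD !rmorphM /=; congr (_ + _ * _).
    by rewrite /delta; case: eqP => _; rewrite ?rmorph1 ?rmorph0.
  rewrite -[in RHS]mul_conjc -[in RHS]mul_conjc; ring.
by move=> E; apply/eqP; rewrite -subr_eq0 -[X in _ == X]E; apply/eqP; ring.
Qed.

(* Shooting from site 0: the energy bound with [f = g = 0] makes the 2x2
   determinant [d] of the boundary values nonzero. *)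
Lemma dirac_truncated f g n : exists P Q,
  [/\ dirac_system a b z f g P Q, P n.+1 = 0 & Q n.+1 = 0].
Proof.
have [P1 [Q1 [P10 Q10 D1]]] := dirac_initial 1 0 0 0.
have [P2 [Q2 [P20 Q20 D2]]] := dirac_initial 0 1 0 0.
have [P3 [Q3 [_ _ D3]]] := dirac_initial 0 0 f g.
have inj l m : l * P1 n.+1 + m * P2 n.+1 = 0 -> l * Q1 n.+1 + m * Q2 n.+1 = 0 ->
    l = 0 /\ m = 0.
  move=> Pn Qn; have := dirac_comb l m D1 D2; rewrite !mulr0 addr0.
  move=> /dirac_truncated_energy/(_ Pn Qn).
  rewrite !Normc.normc0 addr0 mul0r expr0n /= => E.
  have s0 u : 0 <= ssq u n.+1 by apply: sumr_ge0 => k _; rewrite exprn_ge0 // normc_ge0.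
  have z0 u : ssq u n.+1 <= 0 -> u 0%N = 0.
    rewrite /series /= big_nat_recl //= => h.
    apply/eqP; rewrite -normc_eq0 -sqrf_eq0 eq_le exprn_ge0 ?normc_ge0 // andbT.
    apply: le_trans h; rewrite lerDl.
    by apply: sumr_ge0 => k _; rewrite exprn_ge0 // normc_ge0.
  split.
  - have := z0 (fun k => l * P1 k + m * P2 k); rewrite P10 P20 mulr1 mulr0 addr0; apply.
    by apply: le_trans E; rewrite lerDl.
  - have := z0 (fun k => l * Q1 k + m * Q2 k); rewrite Q10 Q20 mulr1 mulr0 add0r; apply.
    by apply: le_trans E; rewrite lerDr.
pose d := P1 n.+1 * Q2 n.+1 - P2 n.+1 * Q1 n.+1.
have d0 : d != 0.
  (* If [d = 0], the combinations with coefficients [(P2, - P1)] and [(Q2, - Q1)] vanish at [n.+1];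
     by [inj] all four boundary values are zero, and then [inj 1 0] is absurd. *)
  apply/negP => /eqP d0.
  have [] := inj (P2 n.+1) (- P1 n.+1); first by ring.
    by rewrite -[RHS]oppr0 -d0 /d; ring.
  move=> p2 /eqP; rewrite oppr_eq0 => /eqP p1.
  have [] := inj (Q2 n.+1) (- Q1 n.+1); first by rewrite -d0 /d; ring.
    by ring.
  move=> q2 /eqP; rewrite oppr_eq0 => /eqP q1.
  have [] := inj 1 0; rewrite ?p1 ?p2 ?q1 ?q2 ?mulr0 ?addr0 //.
  by move=> /eqP; rewrite oner_eq0.
(* Cramer's rule: these coefficients cancel the values of the particular solution [(P3, Q3)] at
   [n.+1]. *)
pose l := (P2 n.+1 * Q3 n.+1 - P3 n.+1 * Q2 n.+1) / d.
pose m := (P3 n.+1 * Q1 n.+1 - P1 n.+1 * Q3 n.+1) / d.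
have D := dirac_comb 1 1 D3 (dirac_comb l m D1 D2).
move: D; rewrite !mulr0 !addr0 !mul1r !addr0 => D.
exists (fun k => 1 * P3 k + 1 * (l * P1 k + m * P2 k)).
exists (fun k => 1 * Q3 k + 1 * (l * Q1 k + m * Q2 k)).
split => //.
- by rewrite /l /m /d; field.
- by rewrite /l /m /d; field.
Qed.

End DiracExistence.

(** * Passage from truncated to square-summable solutions *)

Section UltrafilterLimit.
Variable R : realType.
Local Notation nrm := (@Normc.normc R).
Local Notation ssq u := (series (fun n => nrm (u n) ^+ 2)).

(** Compactness of [[-B, B]] gives a cluster point. An ultrafilter contains each neighbourhood's
    preimage or its complement, and clustering excludes the complement. *)
Lemma ultra_cvg (T : Type) (U : set_system T) (x : T -> R) (B : R) :
  UltraFilter U -> (\forall t \near U, `|x t| <= B) ->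
  exists l : R, x t @[t --> U] --> l.
Proof.
move=> UU xB.
have UP : ProperFilter U by exact: ultra_proper.
have [|l [_ lcl]] := @segment_compact R (- B) B (x t @[t --> U]) _.
  by apply: filterS xB => t /=; rewrite in_itv /= ler_norml.
exists l => A /= lA; have [//|UA] := in_ultra_setVsetC (x @^-1` A) UU.
have [t [/= tA]] := lcl (~` A) A UA lA.
by [].
Qed.

Lemma ultra_ccvg (T : Type) (U : set_system T) (x : T -> R[i]) (B : R) :
  UltraFilter U -> (\forall t \near U, nrm (x t) <= B) ->
  exists l : R[i], ccvg U x l.
Proof.
move=> UU xB.
have UP : ProperFilter U by exact: ultra_proper.
have [|l1 c1] := @ultra_cvg _ U (fun t => complex.Re (x t)) B UU.
  by apply: filterS xB => t; apply: le_trans; exact: Re_le_normc.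
have [|l2 c2] := @ultra_cvg _ U (fun t => complex.Im (x t)) B UU.
  by apply: filterS xB => t; apply: le_trans; exact: Im_le_normc.
by exists (l1 +i* l2).
Qed.

Lemma ccvg_ssq (T : Type) (F : set_system T) (FF : ProperFilter F)
    (x : T -> nat -> R[i]) (u : nat -> R[i]) m :
  (forall k, ccvg F (fun t => x t k) (u k)) ->
  ssq (x t) m @[t --> F] --> ssq u m.
Proof.
move=> xu; rewrite /series /=; elim: m => [|m IH].
  by rewrite big_geq //; under eq_fun do rewrite big_geq //; exact: cvg_cst.
rewrite big_nat_recr //=; under eq_fun do rewrite big_nat_recr //=.
apply: cvgD => //; rewrite normc_sqr; under eq_fun do rewrite normc_sqr.
have [x1 x2] := xu m.
by apply: cvgD; rewrite !expr2; [under eq_fun do rewrite expr2|under eq_fun do rewrite expr2];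
  apply: cvgM.
Qed.

Lemma ccvg_jacobi_act (T : Type) (F : set_system T) (FF : ProperFilter F)
    (a : nat -> R) (b : nat -> R[i]) (x : T -> nat -> R[i]) (u : nat -> R[i]) n :
  (forall k, ccvg F (fun t => x t k) (u k)) ->
  ccvg F (fun t => jacobi_act a b (x t) n) (jacobi_act a b u n).
Proof.
move=> xu; rewrite /jacobi_act; case: n => [|n].
  apply: ccvgD; last exact: ccvgZ.
  by apply: ccvgD; [exact: ccvg_cst | exact: ccvgZ].
by apply: ccvgD; last exact: ccvgZ; apply: ccvgD; exact: ccvgZ.
Qed.

(* The truncated solutions are bounded uniformly in [n], so they converge
   coordinatewise along an ultrafilter; the recurrences pass to the limit. *)
Lemma dirac_l2_solution (a : nat -> R) (b : nat -> R[i]) (z : R[i]) (c : R)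
    (f g : R[i]) :
  (forall n, 0 < a n) -> 0 < c -> z != 0 -> away c (z ^+ 2) ->
  exists P Q, [/\ l2 P, l2 Q & dirac_system a b z f g P Q].
Proof.
move=> a0 c0 z0 cz.
have [x xP] := choice (fun n => dirac_truncated b a0 c0 z0 cz f g n).
have [y xy] := choice xP.
have [U [UU oU]] := @ultraFilterLemma _ (\oo : set_system nat) _.
have UP : ProperFilter U by exact: ultra_proper.
pose B := ((nrm f + nrm g) / (c * nrm z)) ^+ 2.
have K0 : 0 <= (nrm f + nrm g) / (c * nrm z).
  by rewrite divr_ge0 ?addr_ge0 ?mulr_ge0 ?normc_ge0 ?(ltW c0).
have sq0 (u : nat -> R[i]) n : 0 <= nrm (u n) ^+ 2 by rewrite exprn_ge0 // normc_ge0.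
have ssq0 (u : nat -> R[i]) n : 0 <= ssq u n by exact: sumr_ge0.
have xyB n m : (m <= n.+1)%N -> ssq (x n) m <= B /\ ssq (y n) m <= B.
  move=> mn; have [D x0 y0] := xy n.
  have E := dirac_truncated_energy c0 z0 cz D x0 y0.
  split; apply: le_trans E.
    by rewrite ler_wpDr //; apply: series_nondecreasing.
  by rewrite ler_wpDl //; apply: series_nondecreasing.
have bound (v : nat -> nat -> R[i]) :
    (forall n m, (m <= n.+1)%N -> ssq (v n) m <= B) ->
    exists u, l2 u /\ forall k, ccvg U (fun n => v n k) (u k).
  move=> vB.
  have : forall k, exists l, ccvg U (fun n => v n k) l.
    move=> k; apply: (@ultra_ccvg _ U _ ((nrm f + nrm g) / (c * nrm z)) UU).
    apply: oU; exists k => // n /= kn.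
    rewrite -(@ler_pXn2r _ 2) ?nnegrE ?normc_ge0 //.
    apply: le_trans (vB n k.+1 kn); rewrite /series /= big_nat_recr //= lerDr.
    exact: sumr_ge0.
  move=> /choice[u vu]; exists u; split => //.
  apply: (@l2_bounded _ _ B) => m.
  have cm := ccvg_ssq UP (m := m) vu.
  rewrite -(cvg_lim _ cm) //; apply: limr_le; first by apply/cvg_ex; eexists; exact: cm.
  by apply: oU; exists m => // n /= mn; apply: vB; exact: leqW.
have [P [P2 xP']] := bound x (fun n m mn => (xyB n m mn).1).
have [Q [Q2 yQ]] := bound y (fun n m mn => (xyB n m mn).2).
exists P, Q; split => // n; split.
- have JQ := ccvg_jacobi_act UP a (fun k => (b k)^*) n yQ.
  apply: ccvg_uniq JQ _; have C : ccvg U (fun t => z * x t n + f * delta 0 n) (z * P n + f * delta 0 n).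
    by apply: ccvgD; [exact: ccvgZ | exact: ccvg_cst].
  by apply: ccvg_near C; apply: nearW => t; have [D _ _] := xy t; rewrite (D n).1.
- have JP := ccvg_jacobi_act UP a b n xP'.
  apply: ccvg_uniq JP _; have C : ccvg U (fun t => z * y t n + g * delta 0 n) (z * Q n + g * delta 0 n).
    by apply: ccvgD; [exact: ccvgZ | exact: ccvg_cst].
  by apply: ccvg_near C; apply: nearW => t; have [D _ _] := xy t; rewrite (D n).2.
Qed.

End UltrafilterLimit.

(** * The Weyl matrix *)

Section WeylMatrix.
Variable R : realType.
Variables (a : nat -> R) (b : nat -> R[i]) (z : R[i]) (c : R).
Hypotheses (a_gt0 : forall n, 0 < a n) (proper_J : proper_jacobi a b).
Hypotheses (c_gt0 : 0 < c) (z_neq0 : z != 0) (zc : away c (z ^+ 2)).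
Local Notation bar u := (fun n => (u n)^*).
Local Notation e1 := (jacobi_act a (bar b) (delta 0)).
Local Notation JJ := (comp_op (adjoint (jacobi a b)) (jacobi a b)).

Lemma l2_adjoint_delta : l2 e1.
Proof. by apply: l2_jacobi_finite => k; exact: delta_eq0. Qed.

Lemma app_adjoint_delta : app_op (adjoint (jacobi a b)) (delta 0) = e1.
Proof.
rewrite /app_op.
have : exists v, [set v | adjoint (jacobi a b) (delta 0, v)] v.
  exists e1; apply: proper_adjoint_jacobi => //; [exact: l2_delta|].
  exact: l2_adjoint_delta.
by move=> /(xgetPex 0)/adjoint_jacobi[].
Qed.

(** Moving [J^*] off [delta 0] reads the Weyl entries of column index 1 as the value at site 0 of
    [J] applied to the resolvent. *)
Lemma inner_adjoint_delta u : inner e1 u = jacobi_act a b u 0.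
Proof.
rewrite innerE.
have -> : bar e1 = jacobi_act a b (delta 0).
  apply/funext => n; rewrite conj_jacobi_act.
  have -> : bar (delta 0 : nat -> R[i]) = delta 0.
    by apply/funext => k; rewrite /delta; case: eqP; rewrite ?conjc1 ?conjc0.
  by congr jacobi_act; apply/funext => k; rewrite conjcK.
rewrite dotC (@dot_jacobi_finite _ _ _ _ _ 1) ?dot_delta // => k.
exact: delta_eq0.
Qed.

Lemma inner_delta0 (u : nat -> R[i]) : inner (delta 0) u = u 0%N.
Proof.
rewrite innerE dotC; have -> : bar (delta 0 : nat -> R[i]) = delta 0.
  by apply/funext => k; rewrite /delta; case: eqP; rewrite ?conjc1 ?conjc0.
exact: dot_delta.
Qed.

(** [resolvent] is a choice with default 0, so its defining relations become available only once
    some solution is exhibited. *)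
Lemma resolvent_graph f : (exists u, exists2 g, JJ (u, g) & forall n, g n - z ^+ 2 * u n = f n) ->
  let u := resolvent JJ (z ^+ 2) f in
  [/\ l2 u, l2 (jacobi_act a b u) &
   forall n, jacobi_act a (bar b) (jacobi_act a b u) n = z ^+ 2 * u n + f n].
Proof.
move=> /(xgetPex 0); rewrite -/(resolvent JJ (z ^+ 2) f) => -[g [v]].
move=> [/= u2 v2 ve] /adjoint_jacobi[_ g2 ge] gf.
move: u2 v2 ve ge gf; set u := resolvent _ _ _ => u2 v2 ve ge gf.
split => //; first by rewrite -ve.
by move=> n; rewrite -ve -ge -gf addrC subrK.
Qed.

Lemma resolvent_delta : exists P Q,
  [/\ l2 P, l2 Q, dirac_system a b z 1 0 P Q,
      z * resolvent JJ (z ^+ 2) (delta 0) 0 = P 0%N &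
      jacobi_act a b (resolvent JJ (z ^+ 2) (delta 0)) 0 = Q 0%N].
Proof.
have [|u2 v2 E] := @resolvent_graph (delta 0).
  have [P [Q [P2 Q2 D]]] := dirac_l2_solution b 1 0 a_gt0 c_gt0 z_neq0 zc.
  have [JQ2 JP2] := l2_dirac P2 Q2 D.
  have JP : jacobi_act a b (fun n => z^-1 * P n) = Q.
    by apply/funext => n; rewrite jacobi_actZ (D n).2 mul0r addr0 mulKf.
  exists (fun n => z^-1 * P n), (jacobi_act a (bar b) Q).
    exists Q; last exact: proper_adjoint_jacobi.
    by split => //=; exact: l2Z.
  by move=> n; rewrite (D n).1 mul1r expr2 -mulrA mulVKf // addrC addKr.
(* With [u] the resolvent at [delta 0], the Dirac solution is [P = z u], [Q = J u]. *)
exists (fun n => z * resolvent JJ (z ^+ 2) (delta 0) n).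
exists (jacobi_act a b (resolvent JJ (z ^+ 2) (delta 0))); split => //.
  exact: l2Z.
by move=> n; rewrite E jacobi_actZ mul1r mul0r addr0 expr2 mulrA.
Qed.

(** Here the solution is [P = u], [Q = z^-1 (J u - delta_0)]. Solving for [J u] at site 0 produces
    the extra [1], which does not depend on the Jacobi parameters. *)
Lemma resolvent_adjoint_delta : exists P Q,
  [/\ l2 P, l2 Q, dirac_system a b z 0 1 P Q,
      resolvent JJ (z ^+ 2) e1 0 = P 0%N &
      jacobi_act a b (resolvent JJ (z ^+ 2) e1) 0 = z * Q 0%N + 1].
Proof.
have d2 := @l2_delta R 0.
have [|u2 v2 E] := @resolvent_graph e1.
  have [P [Q [P2 Q2 D]]] := dirac_l2_solution b 0 1 a_gt0 c_gt0 z_neq0 zc.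
  have [JQ2 JP2] := l2_dirac P2 Q2 D.
  have JJP n : jacobi_act a (bar b) (jacobi_act a b P) n = z * (z * P n) + e1 n.
    have -> : jacobi_act a b P = (fun k => z * Q k + delta 0 k).
      by apply/funext => k; rewrite (D k).2 mul1r.
    by rewrite jacobi_actD jacobi_actZ (D n).1 mul0r addr0.
  exists P, (jacobi_act a (bar b) (jacobi_act a b P)).
    exists (jacobi_act a b P) => //; apply: proper_adjoint_jacobi => //.
    rewrite (funext JJP); apply: l2D; last exact: l2_adjoint_delta.
    by apply: l2Z; exact: l2Z.
  by move=> n; rewrite JJP expr2 -mulrA addrC addKr.
set u := resolvent JJ (z ^+ 2) e1 in u2 v2 E *.
have JuE : jacobi_act a b u = (fun n => z * (z^-1 * (jacobi_act a b u n - delta 0 n)) + delta 0 n).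
  by apply/funext => n; rewrite mulVKf // subrK.
exists u, (fun n => z^-1 * (jacobi_act a b u n - delta 0 n)); split => //.
- by apply: l2Z; exact: l2B.
- move=> n; split; last by rewrite {1}JuE mul1r.
  have := E n; rewrite {1}JuE jacobi_actD jacobi_actZ => /addIr.
  by rewrite expr2 -mulrA => /(mulfI z_neq0) ->; rewrite mul0r addr0.
- by rewrite {1}JuE /delta eqxx.
Qed.

Lemma weyl_dirac : exists P0 Q0 P1 Q1,
  [/\ l2 P0 /\ l2 Q0, l2 P1 /\ l2 Q1,
      dirac_system a b z 1 0 P0 Q0, dirac_system a b z 0 1 P1 Q1 &
   [/\ z * weyl a b (z ^+ 2) 0 0 = P0 0%N, weyl a b (z ^+ 2) 0 1 = Q0 0%N,
       weyl a b (z ^+ 2) 1 0 = P1 0%N & weyl a b (z ^+ 2) 1 1 = z * Q1 0%N + 1]].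
Proof.
have [P0 [Q0 [P02 Q02 D0 E00 E01]]] := resolvent_delta.
have [P1 [Q1 [P12 Q12 D1 E10 E11]]] := resolvent_adjoint_delta.
exists P0, Q0, P1, Q1; split => //.
have v0 : weyl_vec a b 0 = delta 0 by [].
have v1 : weyl_vec a b 1 = e1 by rewrite /weyl_vec /= app_adjoint_delta.
by split; rewrite mxE ?v0 ?v1 ?inner_delta0 ?inner_adjoint_delta.
Qed.

End WeylMatrix.

(** * Asymptotics in powers of [1/z] *)

Section PowerBounds.
Variables (R : realType) (I : Type) (z : I -> R[i]).
Local Notation nrm := (@Normc.normc R).
Hypothesis z_ge1 : forall i, 1 <= nrm (z i).
Implicit Types (u v : I -> R[i]) (x y : R[i]) (k l : nat).

(** The bound is uniform over the index type, which serves both for sequences and for a whole sector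
    with [|w| >= 1]. *)
Definition pbigO k u := exists C : R, forall i, nrm (u i) <= C * nrm (z i) ^- k.

Let z_gt0 i : 0 < nrm (z i).
Proof. exact: lt_le_trans ltr01 (z_ge1 i). Qed.

Lemma pbigO_ext k u v : (forall i, u i = v i) -> pbigO k u -> pbigO k v.
Proof. by move=> uv [C uC]; exists C => i; rewrite -uv. Qed.

Lemma pbigOD k u v : pbigO k u -> pbigO k v -> pbigO k (fun i => u i + v i).
Proof.
move=> [C uC] [D vD]; exists (C + D) => i; apply: le_trans (normcD _ _) _.
by rewrite mulrDl lerD.
Qed.

Lemma pbigOZ k x u : pbigO k u -> pbigO k (fun i => x * u i).
Proof.
move=> [C uC]; exists (nrm x * C) => i; rewrite Normc.normcM -mulrA.
by apply: ler_wpM2l; first exact: normc_ge0.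
Qed.

Lemma pbigOB k u v : pbigO k u -> pbigO k v -> pbigO k (fun i => u i - v i).
Proof.
move=> uk vk; apply: pbigO_ext (pbigOD uk (pbigOZ (-1) vk)) => i.
by rewrite mulN1r.
Qed.

Lemma pbigOM k l u v : pbigO k u -> pbigO l v -> pbigO (k + l) (fun i => u i * v i).
Proof.
move=> [C uC] [D vD]; exists (C * D) => i; rewrite Normc.normcM exprD invfM mulrACA.
by apply: ler_pM; rewrite ?normc_ge0.
Qed.

Lemma pbigO_leq k l u : (k <= l)%N -> pbigO l u -> pbigO k u.
Proof.
move=> kl [C uC]; exists `|C| => i; apply: le_trans (uC i) _.
apply: (@le_trans _ _ (`|C| * nrm (z i) ^- l)).
  by apply: ler_wpM2r; rewrite ?ler_norm // invr_ge0 exprn_ge0 ?ltW.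
apply: ler_wpM2l => //; rewrite lef_pV2 ?posrE ?exprn_gt0 //.
exact: ler_weXn2l.
Qed.

Lemma pbigO_mulX k l u : pbigO (k + l) u -> pbigO l (fun i => z i ^+ k * u i).
Proof.
move=> [C uC]; exists C => i; rewrite Normc.normcM normcX.
rewrite -ler_pdivlMl ?exprn_gt0 //; apply: le_trans (uC i) _.
by rewrite exprD invfM mulrCA.
Qed.

Lemma pbigO_mul k u : pbigO k (fun i => z i * u i) -> pbigO k.+1 u.
Proof.
move=> [C uC]; exists C => i; have := uC i; rewrite Normc.normcM.
by rewrite -ler_pdivlMl // mulrCA -invfM -exprS.
Qed.

Lemma pbigO_cst x : pbigO 0 (fun=> x).
Proof. by exists (nrm x) => i; rewrite expr0 invr1 mulr1. Qed.

Definition approx_const u x := pbigO 1 (fun i => u i - x).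

Lemma approx_pbigO0 u x : approx_const u x -> pbigO 0 u.
Proof.
move=> /(pbigO_leq (leq0n 1)) ux; apply: pbigO_ext (pbigOD ux (pbigO_cst x)) => i.
by rewrite subrK.
Qed.

Lemma approxD u v x y : approx_const u x -> approx_const v y -> approx_const (fun i => u i + v i) (x + y).
Proof. by move=> ux vy; apply: pbigO_ext (pbigOD ux vy) => i; ring. Qed.

Lemma approxZ u x y : approx_const u x -> approx_const (fun i => y * u i) (y * x).
Proof. by move=> ux; apply: pbigO_ext (pbigOZ y ux) => i; ring. Qed.

Lemma approxM u v x y : approx_const u x -> approx_const v y -> approx_const (fun i => u i * v i) (x * y).
Proof.
move=> ux vy; have v0 := approx_pbigO0 vy.
by apply: pbigO_ext (pbigOD (pbigOM ux v0) (pbigOZ x vy)) => i; ring.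
Qed.

(** The constant [x] is itself [O(1/z)] along an unbounded family. This is how fast decay forces a
    leading coefficient to vanish. *)
Lemma approx_eq0 u x : (forall B : R, exists i, B < nrm (z i)) ->
  approx_const u x -> pbigO 1 u -> x = 0.
Proof.
move=> z_unbounded ux u1; have [C xC] : pbigO 1 (fun=> x).
  by apply: pbigO_ext (pbigOB u1 ux) => i; ring.
apply/eqP; rewrite -normc_eq0 eq_le normc_ge0 andbT leNgt; apply/negP => x0.
have [j] := z_unbounded (C / nrm x); rewrite ltr_pdivrMr // => zj.
have := xC j; rewrite expr1 ler_pdivlMr // mulrC => h.
by have := lt_le_trans zj h; rewrite ltxx.
Qed.

Section Family.
Variables (a : nat -> R) (b : nat -> R[i]) (f g : R[i]).
Variables P Q : I -> nat -> R[i].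
Hypothesis PQ : forall i, dirac_system a b (z i) f g (P i) (Q i).
Hypothesis P1 : forall n, pbigO 1 (fun i => P i n).
Hypothesis Q1 : forall n, pbigO 1 (fun i => Q i n).
Local Notation bar u := (fun n => (u n)^*).

Lemma mulz_PS i n : z i * P i n.+1 = jacobi_act a (bar b) (Q i) n.+1.
Proof. by rewrite (PQ i n.+1).1 /delta /= mulr0 addr0. Qed.

Lemma mulz_QS i n : z i * Q i n.+1 = jacobi_act a b (P i) n.+1.
Proof. by rewrite (PQ i n.+1).2 /delta /= mulr0 addr0. Qed.

Lemma pbigO_jacobi_act (x : nat -> R[i]) (u : I -> nat -> R[i]) k n :
  (forall m, (n <= m)%N -> pbigO k (fun i => u i m)) ->
  pbigO k (fun i => jacobi_act a x (u i) n.+1).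
Proof.
move=> uk; apply: pbigOD; last by apply: pbigOZ; apply: uk; rewrite ltnW.
by apply: pbigOD; apply: pbigOZ; apply: uk.
Qed.

(* Each use of the three-term recurrence gains one power of [z]. *)
Lemma dirac_decay m n : (m <= n)%N ->
  pbigO m.+1 (fun i => P i n) /\ pbigO m.+1 (fun i => Q i n).
Proof.
elim: m n => [|m IH] n mn; first by split.
case: n mn => // n mn; split; apply: pbigO_mul.
- apply: (pbigO_ext (fun i => esym (mulz_PS i n))).
  by apply: pbigO_jacobi_act => k nk; apply: (IH _ (leq_trans (mn : (m <= n)%N) nk)).2.
- apply: (pbigO_ext (fun i => esym (mulz_QS i n))).
  by apply: pbigO_jacobi_act => k nk; apply: (IH _ (leq_trans (mn : (m <= n)%N) nk)).1.
Qed.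

Definition leading_coef n : R[i] := \prod_(k < n) (a k)%:C.

(** The recurrences exchange [P] and [Q] at each site, so the source that dominates a component
    alternates with the parity of the site. *)
Definition parity_pick n (x y : R[i]) := if odd n then y else x.

(** By induction: in the recurrence for [z P] at [n.+1] the term [a_n Q_n] dominates, and
    [dirac_decay] makes the other two smaller by at least one power; likewise for [Q]. At site 0 the
    source itself gives the leading term. *)
Lemma dirac_leading n :
  approx_const (fun i => z i ^+ n.+1 * P i n) (- (leading_coef n * parity_pick n f g)) /\
  approx_const (fun i => z i ^+ n.+1 * Q i n) (- (leading_coef n * parity_pick n g f)).
Proof.
have decay m := dirac_decay (leqnn m).
elim: n => [|n [IHP IHQ]].
  rewrite /leading_coef big_ord0 !mul1r /parity_pick /=; split.
  - have O1 : pbigO 1 (fun i => jacobi_act a (bar b) (Q i) 0).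
      by apply: (pbigO_ext (fun i => esym (jacobi_act0 _ _ _))); apply: pbigOD; apply: pbigOZ.
    apply: pbigO_ext O1 => i; rewrite (PQ i 0).1 /delta /= expr1; ring.
  - have O1 : pbigO 1 (fun i => jacobi_act a b (P i) 0).
      by apply: (pbigO_ext (fun i => esym (jacobi_act0 _ _ _))); apply: pbigOD; apply: pbigOZ.
    apply: pbigO_ext O1 => i; rewrite (PQ i 0).2 /delta /= expr1; ring.
have coefS : leading_coef n.+1 = (a n)%:C * leading_coef n.
  by rewrite /leading_coef big_ord_recr /= mulrC.
have pick x y : parity_pick n.+1 x y = parity_pick n y x.
  by rewrite /parity_pick /=; case: odd.
have rem (x : nat -> R[i]) (u : I -> nat -> R[i]) : (forall m, pbigO m.+1 (fun i => u i m)) ->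
   pbigO 1 (fun i => z i ^+ n.+1 * (x n.+1 * u i n.+1 + (a n.+1)%:C * u i n.+2)).
  move=> uk; apply: pbigO_mulX; rewrite addn1.
  apply: pbigOD; apply: pbigOZ => //.
  by apply: pbigO_leq (uk _).
rewrite !pick coefS; split.
- have := pbigOD (approxZ (a n)%:C IHQ) (rem (bar b) Q (fun m => (decay m).2)).
  apply: pbigO_ext => i; rewrite [z i ^+ n.+2]exprSr -[_ * P i n.+1]mulrA.
  by rewrite mulz_PS jacobi_actS; ring.
- have := pbigOD (approxZ (a n)%:C IHP) (rem b P (fun m => (decay m).1)).
  apply: pbigO_ext => i; rewrite [z i ^+ n.+2]exprSr -[_ * Q i n.+1]mulrA.
  by rewrite mulz_QS jacobi_actS; ring.
Qed.

End Family.
End PowerBounds.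

(** * Green's identity for two Jacobi matrices *)

Section Wronskian.
Variable R : realType.
Local Notation nrm := (@Normc.normc R).
Local Notation bar u := (fun n => (u n)^*).

Definition boundary (a a' : nat -> R) (b b' : nat -> R[i]) n (p q : nat -> R[i]) : R[i] :=
  (b n - b' n) * p n * q n + (a n)%:C * p n * q n.+1 - (a' n)%:C * p n.+1 * q n.

Definition agree (a a' : nat -> R) (b b' : nat -> R[i]) n :=
  forall k, (k < n)%N -> a k = a' k /\ b k = b' k.

(** Add [green] for [J] on [P', P] to [green] for the conjugated matrix on [Q', Q]: the terms in [z]
    cancel at every site and only the sources at site 0 survive. *)
Lemma dirac_wronskian a a' b b' z f g f' g' (P Q P' Q' : nat -> R[i]) n :
  agree a a' b b' n ->
  dirac_system a b z f g P Q -> dirac_system a' b' z f' g' P' Q' ->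
  (g * P' 0%N - g' * P 0%N) + (f * Q' 0%N - f' * Q 0%N) =
  boundary a a' b b' n P' P + boundary a a' (bar b) (bar b') n Q' Q.
Proof.
move=> ab D D'.
have ab' k : (k < n)%N -> a k = a' k /\ (b k)^* = (b' k)^*.
  by move=> /ab[-> ->].
rewrite /boundary -(green P' P ab) -(green Q' Q ab').
rewrite /series /= -big_split /= big_nat_recl //= big1 => [|k _].
  rewrite (D 0%N).1 (D 0%N).2 (D' 0%N).1 (D' 0%N).2 /delta /=; ring.
rewrite (D k.+1).1 (D k.+1).2 (D' k.+1).1 (D' k.+1).2 /delta /=; ring.
Qed.

Section Family.
Variables (I : Type) (z : I -> R[i]).
Hypothesis z_ge1 : forall i, 1 <= nrm (z i).
Variables (a a' : nat -> R) (b b' : nat -> R[i]) (f g f' g' : R[i]).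
Variables P Q P' Q' : I -> nat -> R[i].
Hypothesis PQ : forall i, dirac_system a b (z i) f g (P i) (Q i).
Hypothesis P1 : forall n, pbigO z 1 (fun i => P i n).
Hypothesis Q1 : forall n, pbigO z 1 (fun i => Q i n).
Hypothesis PQ' : forall i, dirac_system a' b' (z i) f' g' (P' i) (Q' i).
Hypothesis P1' : forall n, pbigO z 1 (fun i => P' i n).
Hypothesis Q1' : forall n, pbigO z 1 (fun i => Q' i n).

Definition wronskian0 i :=
  (g * P' i 0%N - g' * P i 0%N) + (f * Q' i 0%N - f' * Q i 0%N).

Lemma pbigO_boundary (x x' : nat -> R[i]) (u v : I -> nat -> R[i]) n :
  (forall m, pbigO z m.+1 (fun i => u i m)) ->
  (forall m, pbigO z m.+1 (fun i => v i m)) ->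
  pbigO z (n.+1 + n.+1) (fun i => boundary a a' x x' n (u i) (v i)).
Proof.
move=> un vn; apply: pbigOB; first apply: pbigOD.
- by apply: pbigO_ext (pbigOZ (x n - x' n) (pbigOM (un n) (vn n))) => i; rewrite mulrA.
- apply: (@pbigO_leq _ _ _ z_ge1 _ (n.+1 + n.+2)); first by rewrite leq_add2l.
  by apply: pbigO_ext (pbigOZ (a n)%:C (pbigOM (un n) (vn n.+1))) => i; rewrite mulrA.
- apply: (@pbigO_leq _ _ _ z_ge1 _ (n.+2 + n.+1)); first by rewrite leq_add2r.
  by apply: pbigO_ext (pbigOZ (a' n)%:C (pbigOM (un n.+1) (vn n))) => i; rewrite mulrA.
Qed.

Let decay m := dirac_decay z_ge1 PQ P1 Q1 (leqnn m).
Let decay' m := dirac_decay z_ge1 PQ' P1' Q1' (leqnn m).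

Lemma pbigO_wronskian n : agree a a' b b' n -> pbigO z (n.+1 + n.+1) wronskian0.
Proof.
move=> ab.
apply: (pbigO_ext (fun i => esym (dirac_wronskian ab (PQ i) (PQ' i)))).
apply: pbigOD; apply: pbigO_boundary => m.
- exact: (decay' m).1.
- exact: (decay m).1.
- exact: (decay' m).2.
- exact: (decay m).2.
Qed.

Lemma leading_coef_agree n : agree a a' b b' n -> leading_coef a' n = leading_coef a n.
Proof. by move=> ab; apply: eq_bigr => k _; rewrite (ab k (ltn_ord k)).1. Qed.

(** The off-diagonal terms pair sites [n] and [n.+1] and so decay one power faster than the diagonal
    one. *)
Lemma approx_boundary (x x' : nat -> R[i]) (u v : I -> nat -> R[i]) n p q :
  (forall m, pbigO z m.+1 (fun i => u i m)) ->
  (forall m, pbigO z m.+1 (fun i => v i m)) ->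
  approx_const z (fun i => z i ^+ n.+1 * u i n) p ->
  approx_const z (fun i => z i ^+ n.+1 * v i n) q ->
  approx_const z (fun i => z i ^+ (n.+1 + n.+1) * boundary a a' x x' n (u i) (v i))
    ((x n - x' n) * (p * q)).
Proof.
move=> un vn up vq.
have E1 : pbigO z 1 (fun i => z i ^+ (n.+1 + n.+1) * ((a n)%:C * (u i n * v i n.+1))).
  apply: pbigO_mulX => //; apply: pbigOZ.
  by rewrite addn1 -addnS; apply: pbigOM.
have E2 : pbigO z 1 (fun i => z i ^+ (n.+1 + n.+1) * ((a' n)%:C * (u i n.+1 * v i n))).
  apply: pbigO_mulX => //; apply: pbigOZ.
  by rewrite addn1 -addSn; apply: pbigOM.
apply: pbigO_ext (pbigOD (approxZ (x n - x' n) (approxM z_ge1 up vq)) (pbigOB E1 E2)) => i.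
by rewrite /boundary exprD; ring.
Qed.

(** Once the diagonal entries agree, the off-diagonal terms become the leading ones, one order
    further down. *)
Lemma approx_boundary_diag (x x' : nat -> R[i]) (u v : I -> nat -> R[i]) n p q p' q' :
  x n = x' n ->
  approx_const z (fun i => z i ^+ n.+1 * u i n) p ->
  approx_const z (fun i => z i ^+ n.+1 * v i n) q ->
  approx_const z (fun i => z i ^+ n.+2 * u i n.+1) p' ->
  approx_const z (fun i => z i ^+ n.+2 * v i n.+1) q' ->
  approx_const z (fun i => z i ^+ (n.+1 + n.+2) * boundary a a' x x' n (u i) (v i))
    ((a n)%:C * (p * q') - (a' n)%:C * (p' * q)).
Proof.
move=> xx up vq up' vq'.
have E1 := approxZ (a n)%:C (approxM z_ge1 up vq').
have E2 := approxZ (- (a' n)%:C) (approxM z_ge1 up' vq).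
apply: pbigO_ext (approxD E1 E2) => i.
by rewrite /boundary xx subrr exprD [z i ^+ n.+2]exprS; ring.
Qed.

Let lead n := dirac_leading z_ge1 PQ P1 Q1 n.
Let lead' n := dirac_leading z_ge1 PQ' P1' Q1' n.

Lemma approx_wronskian n : agree a a' b b' n ->
  approx_const z (fun i => z i ^+ (n.+1 + n.+1) * wronskian0 i)
    (leading_coef a n ^+ 2 *
      ((b n - b' n) * (parity_pick n f' g' * parity_pick n f g)
       + (b n - b' n)^* * (parity_pick n g' f' * parity_pick n g f))).
Proof.
move=> ab; have L := leading_coef_agree ab.
have E1 := approx_boundary b b' (fun m => (decay' m).1) (fun m => (decay m).1)
  (lead' n).1 (lead n).1.
have E2 := approx_boundary (bar b) (bar b') (fun m => (decay' m).2) (fun m => (decay m).2)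
  (lead' n).2 (lead n).2.
apply: pbigO_ext (approxD E1 E2) => i.
rewrite /wronskian0 (dirac_wronskian ab (PQ i) (PQ' i)) L rmorphB /=; ring.
Qed.

Lemma approx_wronskian_diag n : agree a a' b b' n -> b n = b' n ->
  approx_const z (fun i => z i ^+ (n.+1 + n.+2) * wronskian0 i)
    (leading_coef a n ^+ 2 *
      ((a n)%:C ^+ 2 * (parity_pick n f' g' * parity_pick n g f
         + parity_pick n g' f' * parity_pick n f g)
       - (a' n)%:C ^+ 2 * (parity_pick n g' f' * parity_pick n f g
         + parity_pick n f' g' * parity_pick n g f))).
Proof.
move=> ab bb; have L := leading_coef_agree ab.
have bb' : (b n)^* = (b' n)^* by rewrite bb.
have E1 := approx_boundary_diag bb (lead' n).1 (lead n).1 (lead' n.+1).1 (lead n.+1).1.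
have E2 := @approx_boundary_diag (bar b) (bar b') _ _ _ _ _ _ _ bb'
  (lead' n).2 (lead n).2 (lead' n.+1).2 (lead n.+1).2.
have coefS (d : nat -> R) : leading_coef d n.+1 = (d n)%:C * leading_coef d n.
  by rewrite /leading_coef big_ord_recr /= mulrC.
have pick x y : parity_pick n.+1 x y = parity_pick n y x :> R[i].
  by rewrite /parity_pick /=; case: odd.
apply: pbigO_ext (approxD E1 E2) => i.
rewrite /wronskian0 (dirac_wronskian ab (PQ i) (PQ' i)) !coefS !pick L; ring.
Qed.

End Family.
End Wronskian.

(** * The scaled difference of Weyl matrices *)

Section OperatorNorm.
Variable R : realType.
Implicit Type A : 'M[R[i]]_2.
Local Notation nrm := (@Normc.normc R).

Lemma normc_le_l2norm2 (v : 'cV[R[i]]_2) i : nrm (v i 0) <= l2norm2 v.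
Proof.
have s0 (P : pred 'I_2) : 0 <= \sum_(k | P k) nrm (v k 0) ^+ 2.
  by apply: sumr_ge0 => k _; rewrite exprn_ge0 // normc_ge0.
rewrite -(@ler_pXn2r _ 2) ?nnegrE ?normc_ge0 ?sqrtr_ge0 // sqr_sqrtr //.
by rewrite (bigD1 i) //= lerDl.
Qed.

Lemma l2norm2_le (v : 'cV[R[i]]_2) : l2norm2 v <= \sum_i nrm (v i 0).
Proof.
have s0 : 0 <= \sum_i nrm (v i 0) by apply: sumr_ge0 => k _; exact: normc_ge0.
rewrite -(@ler_pXn2r _ 2) ?nnegrE ?sqrtr_ge0 // sqr_sqrtr; last first.
  by apply: sumr_ge0 => k _; rewrite exprn_ge0 // normc_ge0.
rewrite !big_ord_recl !big_ord0 !addr0 sqrrD -addrA lerD2l lerDr.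
by rewrite mulrn_wge0 // mulr_ge0 ?normc_ge0.
Qed.

Lemma l2norm2_mulmx A v : l2norm2 v <= 1 ->
  l2norm2 (A *m v) <= \sum_i \sum_j nrm (A i j).
Proof.
move=> v1; apply: le_trans (l2norm2_le _) _; apply: ler_sum => k _.
rewrite mxE; apply: le_trans (normc_sum _ _ _) _; apply: ler_sum => l _.
rewrite Normc.normcM ler_piMr ?normc_ge0 //.
exact: le_trans (normc_le_l2norm2 _ _) v1.
Qed.

Lemma opnorm_le A : opnorm A <= \sum_i \sum_j nrm (A i j).
Proof.
apply: ge_sup; last by move=> _ [v v1 <-]; exact: l2norm2_mulmx.
exists (l2norm2 (A *m 0)), 0 => //=.
apply: le_trans (l2norm2_le _) _.
by rewrite big1 // => k _; rewrite mxE Normc.normc0.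
Qed.

(** Apply [A] to a basis vector; the entrywise bound [l2norm2_mulmx] ensures that the supremum is
    over a bounded set. *)
Lemma normc_le_opnorm A i j : nrm (A i j) <= opnorm A.
Proof.
apply: (@le_trans _ _ (l2norm2 (A *m delta_mx j 0))).
  by rewrite -colE; have := normc_le_l2norm2 (col j A) i; rewrite mxE.
apply: ub_le_sup.
  by exists (\sum_i \sum_j nrm (A i j)) => _ [v v1 <-]; exact: l2norm2_mulmx.
exists (delta_mx j 0) => //=; apply: le_trans (l2norm2_le _) _.
rewrite (bigD1 j) //= big1 => [|k kj]; rewrite mxE ?eqxx ?Normc.normc1 ?addr0 //.
by rewrite (negbTE kj) Normc.normc0.
Qed.

Lemma sigma3_quarter_conj w A (r := 4.-root w) :
  let B := sigma3_quarter w *m A *m sigma3_quarter w in w != 0 ->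
  [/\ B 0 0 = r ^+ 2 * A 0 0, B 0 1 = A 0 1, B 1 0 = A 1 0 &
      B 1 1 = (r ^+ 2)^-1 * A 1 1].
Proof.
move=> B w0; have r0 : r != 0 by rewrite rootC_eq0.
rewrite /B /sigma3_quarter mul_mx_diag mul_diag_mx.
by rewrite !mxE /= -/r; split => //; field.
Qed.

End OperatorNorm.

(** * Weyl matrices along a family of points in a sector *)

Section WeylFamily.
Variable R : realType.
Local Notation nrm := (@Normc.normc R).
Variables (I : Type) (w : I -> R[i]) (eps : R).
Hypotheses (eps_gt0 : 0 < eps) (w_sector : forall i, sector eps (w i)).
Hypothesis w_ge1 : forall i, 1 <= nrm (w i).

(* The branch of the square root is immaterial: only [root2 i ^+ 2 = w i] is used. *)
Definition root2 i := (4.-root (w i)) ^+ 2.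

Lemma root2_sqr i : root2 i ^+ 2 = w i.
Proof. by rewrite /root2 -exprM rootCK. Qed.

Lemma normc_root2 i : nrm (root2 i) ^+ 2 = nrm (w i).
Proof. by rewrite -normcX root2_sqr. Qed.

Lemma root2_ge1 i : 1 <= nrm (root2 i).
Proof. by rewrite -(@expr_ge1 _ 2) ?normc_ge0 // normc_root2. Qed.

Record weyl_solutions (a : nat -> R) (b : nat -> R[i])
    (P0 Q0 P1 Q1 : I -> nat -> R[i]) : Prop := {
  weyl_dirac0 : forall i, dirac_system a b (root2 i) 1 0 (P0 i) (Q0 i);
  weyl_dirac1 : forall i, dirac_system a b (root2 i) 0 1 (P1 i) (Q1 i);
  weyl_P0 : forall n, pbigO root2 1 (fun i => P0 i n);
  weyl_Q0 : forall n, pbigO root2 1 (fun i => Q0 i n);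
  weyl_P1 : forall n, pbigO root2 1 (fun i => P1 i n);
  weyl_Q1 : forall n, pbigO root2 1 (fun i => Q1 i n);
  weyl_symm : forall i, P0 i 0%N = Q1 i 0%N;
  weyl00 : forall i, root2 i * weyl a b (w i) 0 0 = P0 i 0%N;
  weyl01 : forall i, weyl a b (w i) 0 1 = Q0 i 0%N;
  weyl10 : forall i, weyl a b (w i) 1 0 = P1 i 0%N;
  weyl11 : forall i, weyl a b (w i) 1 1 = root2 i * Q1 i 0%N + 1 }.

Lemma weyl_solutions_exist a b : (forall n, 0 < a n) -> proper_jacobi a b ->
  exists P0 Q0 P1 Q1, weyl_solutions a b P0 Q0 P1 Q1.
Proof.
move=> a0 proper; pose c := Num.sqrt ((1 - cos eps) / 2).
have c0 i : 0 < c := sector_away_gt0 eps_gt0 (w_sector i).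
have z0 i : root2 i != 0.
  by rewrite -normc_gt0; exact: lt_le_trans ltr01 (root2_ge1 i).
have wc i : away c (root2 i ^+ 2).
  by rewrite root2_sqr; exact: sector_away eps_gt0 (w_sector i).
have [P0 /choice[Q0 /choice[P1 /choice[Q1 H]]]] :=
  choice (fun i => weyl_dirac a0 proper (c0 i) (z0 i) (wc i)).
(* The constant [(|f| + |g|) / c] is uniform in [i], since [c] depends only on the opening of the
   sector. *)
have bound f g (P Q : I -> nat -> R[i]) :
    (forall i, [/\ l2 (P i), l2 (Q i) & dirac_system a b (root2 i) f g (P i) (Q i)]) ->
    forall n, pbigO root2 1 (fun i => P i n) /\ pbigO root2 1 (fun i => Q i n).
  move=> PQ n; have B i : nrm (P i n) <= (nrm f + nrm g) / c * nrm (root2 i) ^- 1 /\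
      nrm (Q i n) <= (nrm f + nrm g) / c * nrm (root2 i) ^- 1.
    have [P2 Q2 D] := PQ i.
    rewrite expr1 -mulrA -invfM.
    exact: dirac_bound proper (c0 i) (z0 i) (wc i) P2 Q2 D n.
  by split; exists ((nrm f + nrm g) / c) => i; case: (B i).
have B0 := bound 1 0 P0 Q0 (fun i => let: And5 (conj p q) _ d _ _ := H i in And3 p q d).
have B1 := bound 0 1 P1 Q1 (fun i => let: And5 _ (conj p q) _ d _ := H i in And3 p q d).
exists P0, Q0, P1, Q1; split => [i|i|n|n|n|n|i|i|i|i|i].
- by case: (H i).
- by case: (H i).
- exact: (B0 n).1.
- exact: (B0 n).2.
- exact: (B1 n).1.
- exact: (B1 n).2.
- by have [[p0 q0] [p1 q1] d0 d1 _] := H i; exact: dirac_symm d0 d1.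
- by have [_ _ _ _ [E _ _ _]] := H i; rewrite -E root2_sqr.
- by have [_ _ _ _ [_ E _ _]] := H i; rewrite -E root2_sqr.
- by have [_ _ _ _ [_ _ E _]] := H i; rewrite -E root2_sqr.
- by have [_ _ _ _ [_ _ _ E]] := H i; rewrite -E root2_sqr.
Qed.

Variables (a a' : nat -> R) (b b' : nat -> R[i]).
Hypotheses (a_gt0 : forall n, 0 < a n) (a'_gt0 : forall n, 0 < a' n).
Hypotheses (proper_J : proper_jacobi a b) (proper_J' : proper_jacobi a' b').

Definition scaled_diff (v : R[i]) :=
  sigma3_quarter v *m (weyl a b v - weyl a' b' v) *m sigma3_quarter v.

(** The scaling multiplies or divides the diagonal entries by [root2 i], and the additive [1] of
    [weyl11] cancels in the difference. *)
Lemma scaled_diff_solutions P0 Q0 P1 Q1 P0' Q0' P1' Q1' i :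
  weyl_solutions a b P0 Q0 P1 Q1 -> weyl_solutions a' b' P0' Q0' P1' Q1' ->
  [/\ scaled_diff (w i) 0 0 = P0 i 0%N - P0' i 0%N,
      scaled_diff (w i) 0 1 = Q0 i 0%N - Q0' i 0%N,
      scaled_diff (w i) 1 0 = P1 i 0%N - P1' i 0%N &
      scaled_diff (w i) 1 1 = Q1 i 0%N - Q1' i 0%N].
Proof.
move=> S S'.
have w0 : w i != 0 by rewrite -normc_gt0; exact: lt_le_trans ltr01 (w_ge1 i).
have z0 : root2 i != 0 by rewrite expf_neq0 // rootC_eq0.
have [-> -> -> ->] := sigma3_quarter_conj (weyl a b (w i) - weyl a' b' (w i)) w0.
have dE (A B : 'M[R[i]]_2) j k : (A - B) j k = A j k - B j k by rewrite !mxE.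
rewrite !dE -/(root2 i); split.
- by rewrite mulrBr (weyl00 S) (weyl00 S').
- by rewrite (weyl01 S) (weyl01 S').
- by rewrite (weyl10 S) (weyl10 S').
- by rewrite (weyl11 S) (weyl11 S'); field.
Qed.

(** Equal sources in the Wronskian give the off-diagonal entries; the mixed sources [(1, 0)] and
    [(0, 1)] give both diagonal ones, through [weyl_symm]. *)
Lemma scaled_diff_decay n : agree a a' b b' n ->
  forall j k, pbigO root2 (n.+1 + n.+1) (fun i => scaled_diff (w i) j k).
Proof.
move=> ab.
have [P0 [Q0 [P1 [Q1 S]]]] := weyl_solutions_exist a_gt0 proper_J.
have [P0' [Q0' [P1' [Q1' S']]]] := weyl_solutions_exist a'_gt0 proper_J'.
have SE i := scaled_diff_solutions i S S'.
have O01 := pbigO_wronskian root2_ge1 (weyl_dirac0 S) (weyl_P0 S) (weyl_Q0 S)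
  (weyl_dirac0 S') (weyl_P0 S') (weyl_Q0 S') ab.
have O10 := pbigO_wronskian root2_ge1 (weyl_dirac1 S) (weyl_P1 S) (weyl_Q1 S)
  (weyl_dirac1 S') (weyl_P1 S') (weyl_Q1 S') ab.
have O00 := pbigO_wronskian root2_ge1 (weyl_dirac0 S) (weyl_P0 S) (weyl_Q0 S)
  (weyl_dirac1 S') (weyl_P1 S') (weyl_Q1 S') ab.
have I2 (j : 'I_2) : j = 0 \/ j = 1.
  by case: j => [[|[|]]] // p; [left|right]; apply: val_inj.
move=> j k; have [->|->] := I2 j; have [->|->] := I2 k.
- apply: pbigO_ext (pbigOZ (-1) O00) => i; rewrite /wronskian0.
  by have [-> _ _ _] := SE i; rewrite -(weyl_symm S'); ring.
- apply: pbigO_ext (pbigOZ (-1) O01) => i; rewrite /wronskian0.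
  by have [_ -> _ _] := SE i; ring.
- apply: pbigO_ext (pbigOZ (-1) O10) => i; rewrite /wronskian0.
  by have [_ _ -> _] := SE i; ring.
- apply: pbigO_ext (pbigOZ (-1) O00) => i; rewrite /wronskian0.
  by have [_ _ _ ->] := SE i; rewrite -(weyl_symm S); ring.
Qed.

Lemma leading_coef_neq0 n : leading_coef a n != 0.
Proof.
by apply/prodf_neq0 => k _; rewrite eq_complex /= gt_eqF.
Qed.

(** Induction on the site [m < n]: the coefficient of order [2m + 2] in entry [(0, 1)] determines
    [b m], then that of order [2m + 3] in entry [(0, 0)] determines [a m]. Both orders lie below the
    assumed decay [2n + 2]. *)
Lemma agree_of_decay n : (forall B : R, exists i, B < nrm (w i)) ->
  (forall j k, pbigO root2 (n.+1 + n.+1) (fun i => scaled_diff (w i) j k)) ->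
  agree a a' b b' n.
Proof.
move=> w_unbounded dec.
have z_unbounded (B : R) : exists i, B < nrm (root2 i).
  have [i Bi] := w_unbounded (B ^+ 2); exists i.
  rewrite ltNge; apply/negP => zB; move: Bi; rewrite ltNge -normc_root2.
  by rewrite ler_pXn2r ?nnegrE ?normc_ge0 ?zB // (le_trans (normc_ge0 _) zB).
have [P0 [Q0 [P1 [Q1 S]]]] := weyl_solutions_exist a_gt0 proper_J.
have [P0' [Q0' [P1' [Q1' S']]]] := weyl_solutions_exist a'_gt0 proper_J'.
have SE i := scaled_diff_solutions i S S'.
have dec' k u v : pbigO root2 (n.+1 + n.+1) u -> (k + 1 <= n.+1 + n.+1)%N ->
    (forall i, -1 * u i = v i) -> pbigO root2 1 (fun i => root2 i ^+ k * v i).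
  move=> uO kn uv; apply: (pbigO_mulX root2_ge1); apply: (pbigO_leq root2_ge1 kn).
  exact: (pbigO_ext uv (pbigOZ (-1) uO)).
suff H m : (m <= n)%N -> agree a a' b b' m by exact: H.
elim: m => [|m IH] mn; first by move=> k.
have ab := IH (ltnW mn); move=> k; rewrite ltnS leq_eqVlt => /orP[/eqP ->|]; last exact: ab.
have coef0 := leading_coef_neq0 m.
have bb : b m = b' m.
  have A := approx_wronskian root2_ge1 (weyl_dirac0 S) (weyl_P0 S) (weyl_Q0 S)
    (weyl_dirac0 S') (weyl_P0 S') (weyl_Q0 S') ab.
  have dec01 i : -1 * scaled_diff (w i) 0 1 = wronskian0 1 0 1 0 P0 Q0 P0' Q0' i.
    by have [_ -> _ _] := SE i; rewrite /wronskian0; ring.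
  have mn2 : (m.+1 + m.+1 + 1 <= n.+1 + n.+1)%N by lia.
  have /eqP := approx_eq0 root2_ge1 z_unbounded A (dec' _ _ _ (dec 0 1) mn2 dec01).
  rewrite mulf_eq0 expf_eq0 (negbTE coef0) andbF /=.
  (* For equal sources only one summand survives: the conjugate of [b m - b' m] at odd [m], the
     difference itself at even [m]. *)
  rewrite /parity_pick; case: odd; rewrite !mulr1 !mulr0 ?addr0 ?add0r.
    by rewrite conjc_eq0 subr_eq0 => /eqP.
  by rewrite subr_eq0 => /eqP.
split => //.
have A := approx_wronskian_diag root2_ge1 (weyl_dirac0 S) (weyl_P0 S) (weyl_Q0 S)
  (weyl_dirac1 S') (weyl_P1 S') (weyl_Q1 S') ab bb.
have dec00 i : -1 * scaled_diff (w i) 0 0 = wronskian0 1 0 0 1 P0 Q0 P1' Q1' i.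
  by have [-> _ _ _] := SE i; rewrite /wronskian0 -(weyl_symm S'); ring.
have mn2 : (m.+1 + m.+2 + 1 <= n.+1 + n.+1)%N by lia.
have /eqP := approx_eq0 root2_ge1 z_unbounded A (dec' _ _ _ (dec 0 0) mn2 dec00).
rewrite mulf_eq0 expf_eq0 (negbTE coef0) andbF /=.
have pick1 : parity_pick m 0 1 * parity_pick m 0 1 +
    parity_pick m 1 0 * parity_pick m 1 0 = 1 :> R[i].
  by rewrite /parity_pick; case: odd; ring.
rewrite pick1 [X in _ - _ * X]addrC pick1.
rewrite !mulr1 subr_eq0 -!rmorphXn /= => /eqP[].
(* The expansion sees only squares of the off-diagonal entries; positivity recovers [a m]. *)
by move=> /eqP; rewrite eqrXn2 ?ltW // => /eqP.
Qed.

End WeylFamily.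

(** * From agreement of parameters to sector bounds, and back from a sequence *)

Section Equivalence.
Variable R : realType.
Local Notation nrm := (@Normc.normc R).

Lemma root2_expN (I : Type) (w : I -> R[i]) n i :
  nrm (root2 w i) ^- (n + n) = nrm (w i) ^- n.
Proof. by rewrite addnn -mul2n exprM normc_root2. Qed.

Variables (a a' : nat -> R) (b b' : nat -> R[i]).
Hypotheses (a_gt0 : forall n, 0 < a n) (a'_gt0 : forall n, 0 < a' n).
Hypotheses (proper_J : proper_jacobi a b) (proper_J' : proper_jacobi a' b').
Local Notation D w := (opnorm (scaled_diff a a' b b' w)).

Lemma agree_sector_bound n (eps : R) : agree a a' b b' n -> 0 < eps ->
  exists C r : R, forall w : R[i], sector eps w -> r <= nrm w ->
    D w <= C * nrm w ^- n.+1.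
Proof.
move=> ab eps0.
(* Indexing by all admissible points at once makes the constants of [pbigO] uniform in the
   sector. *)
pose I := {w : R[i] | sector eps w /\ 1 <= nrm w}.
have dec := @scaled_diff_decay R I sval eps eps0 (fun i => (svalP i).1)
  (fun i => (svalP i).2) a a' b b' a_gt0 a'_gt0 proper_J proper_J' n ab.
have [C00 c00] := dec 0 0; have [C01 c01] := dec 0 1.
have [C10 c10] := dec 1 0; have [C11 c11] := dec 1 1.
exists (C00 + C01 + (C10 + C11)), 1 => w ws w1.
pose i : I := exist _ w (conj ws w1).
apply: le_trans (opnorm_le _) _.
rewrite !big_ord_recl !big_ord0 !addr0 !mulrDl.
have lift1 : lift ord0 ord0 = 1 :> 'I_2 by apply: val_inj.
have ord00 : ord0 = 0 :> 'I_2 by apply: val_inj.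
rewrite lift1 ord00.
move: (c00 i) (c01 i) (c10 i) (c11 i); rewrite root2_expN => h00 h01 h10 h11.
by apply: lerD; apply: lerD.
Qed.

Lemma agree_of_sequence n (eps C : R) (w : nat -> R[i]) : 0 < eps ->
  (forall j, sector eps (w j)) -> nrm (w j) @[j --> \oo] --> +oo ->
  (\forall j \near \oo, D (w j) <= C * nrm (w j) ^- n.+1) ->
  agree a a' b b' n.
Proof.
move=> eps0 ws woo DC.
have w1 : \forall j \near \oo, 1 <= nrm (w j) by move/cvgryPge: woo; apply.
have [j0 _ j0P] : \forall j \near \oo,
    1 <= nrm (w j) /\ D (w j) <= C * nrm (w j) ^- n.+1.
  by near do split.
(* Passing to a tail makes the eventual bounds hold at every index, as [pbigO] requires. *)
pose v j := w (j0 + j)%N.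
have vP j : 1 <= nrm (v j) /\ D (v j) <= C * nrm (v j) ^- n.+1.
  by apply: j0P => /=; exact: leq_addr.
apply: (@agree_of_decay R nat v eps eps0 (fun j => ws _) (fun j => (vP j).1)
  _ _ _ _ a_gt0 a'_gt0 proper_J proper_J').
  move=> B; have [k _ kP] : \forall j \near \oo, B < nrm (w j).
    by move/cvgryPgt: woo; apply.
  by exists k; apply: kP => /=; exact: leq_addl.
move=> j k; exists C => i; rewrite root2_expN.
exact: le_trans (normc_le_opnorm _ _ _) (vP i).2.
Unshelve. all: by end_near. Qed.

End Equivalence.

Unset Implicit Arguments.
Set Printing Implicit Defensive.

Theorem theorem1p6 (R : realType) (a a' : nat -> R) (b b' : nat -> R[i])
    (a_gt0 : forall n, 0 < a n) (a'_gt0 : forall n, 0 < a' n)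
    (proper_J : proper_jacobi a b) (proper_J' : proper_jacobi a' b')
    (N : nat) (N_ge2 : (2 <= N)%N) :
  let D := fun w : R[i] =>
    opnorm (sigma3_quarter w *m (weyl a b w - weyl a' b' w)
              *m sigma3_quarter w) in
  let P1 := exists (eps : R) (w : nat -> R[i]),
    [/\ 0 < eps, (forall j, sector eps (w j)),
        Normc.normc (w j) @[j --> \oo] --> +oo &
        exists C : R, \forall j \near \oo,
          D (w j) <= C * Normc.normc (w j) ^- N] in
  let P2 := forall n : nat, (n <= N - 2)%N -> a n = a' n /\ b n = b' n in
  let P3 := forall eps : R, 0 < eps ->
    exists C r : R, forall w : R[i], sector eps w -> r <= Normc.normc w ->
      D w <= C * Normc.normc w ^- N in
  (P1 <-> P2) /\ (P2 <-> P3).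
Proof.
move=> D P1 P2 P3.
(* Since [N >= 2], the condition [n <= N - 2] is the same as [n < N.-1]. *)
have P2E : P2 <-> agree a a' b b' N.-1.
  split=> ab k kN; apply: ab; lia.
have NE : N = N.-1.+1 by lia.
have P23 : P2 -> P3.
  move=> /P2E ab eps eps0; rewrite NE.
  exact: (agree_sector_bound a_gt0 a'_gt0 proper_J proper_J' ab eps0).
have P31 : P3 -> P1.
  (* For [eps = pi] the sector is the negative half-line; the sequence is [-(j + 1)], shifted by one
     to avoid the origin. *)
  move=> /(_ pi (pi_gt0 R))[C [r Cr]].
  pose w j : R[i] := (j%:R * cos pi) +i* (j%:R * sin pi).
  pose v j := w j.+1.
  have vs j : sector pi (v j).
    exists j.+1%:R, pi; split => //.
    by rewrite lexx /= mulr_natl mulr2n addrK.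
  have nv j : Normc.normc (v j) = j.+1%:R by rewrite normc_polar.
  have voo : Normc.normc (v j) @[j --> \oo] --> +oo.
    under eq_fun do rewrite nv.
    by have := @cvgr_idn R; rewrite -(cvg_shiftS).
  exists pi, v; split => //; first exact: pi_gt0.
  exists C; have vr : \forall j \near \oo, r <= Normc.normc (v j).
    by move/cvgryPge: voo; apply.
  by apply: filterS vr => j rj; exact: Cr.
have P12 : P1 -> P2.
  move=> [eps [w [eps0 ws woo [C DC]]]]; apply/P2E.
  apply: (agree_of_sequence a_gt0 a'_gt0 proper_J proper_J' eps0 ws woo (C := C)).
  by rewrite -NE.
by split; split => // ?; [apply: P31; apply: P23 | apply: P12; apply: P31].
Qed.
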